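(* Let $y\in\Omega_Y$ be fixed and set $x_n=T_n(y)$ (which lies in $\mathbb{Z}_+^d$ for $n\ge y(i)$). Then $$\lim_{n\to\infty}P_{x_n}(\tau_n<\tau_0)=P_y(\tau<\infty).$$
   Context: Let $d\ge 2$, $\mathcal N_0=\{0,1,\dots,d\}$, $\mathcal N_+=\{1,\dots,d\}$; $e_1,\dots,e_d$ are the unit vectors of $\mathbb{Z}^d$, $e_0=0$, and $x(j)$ denotes the $j$-th component of $x$. Let $p=(p(j,k))_{j,k\in\mathcal N_0}$ be a nonnegative matrix with $p(j,j)=0$ and $\sum_{j,k}p(j,k)=1$, irreducible (the directed graph on $\mathcal N_0$ with an edge $j\to k$ whenever $p(j,k)>0$ is strongly connected). Put $\lambda_j=p(0,j)$, $\mu_j=\sum_{k\in\mathcal N_0}p(j,k)$ for $j\in\mathcal N_+$, $r(j,k)=p(j,k)/\mu_j$, and let $(\nu_j)_{j\in\mathcal N_+}$ be the unique solution of $\nu_j=\lambda_j+\sum_{k\in\mathcal N_+}\nu_k r(k,j)$. Stability is assumed: $\rho_j=\nu_j/\mu_j<1$ for all $j\in\mathcal N_+$. Let $I_0,I_1,\dots$ be i.i.d. with $P(I_k=e_l-e_j)=p(j,l)$ for $j\ne l\in\mathcal N_0$. The process $X$ on $\mathbb{Z}_+^d$ is: $X_0=x$; $X_{k+1}=X_k+I_k$ if $X_k+I_k\in\mathbb{Z}_+^d$ and $X_{k+1}=X_k$ otherwise. $\tau_n$ is the first time $k$ at which $\sum_{j=1}^dX_k(j)=n$; $\tau_0$ is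 the first time $X$ hits $0$. Fix $i\in\mathcal N_+$. $T_n:\mathbb{R}^d\to\mathbb{R}^d$ is defined by $T_n(x)(i)=n-x(i)$ and $T_n(x)(j)=x(j)$ for $j\ne i$. Let $J_k$ be $I_k$ with the sign of its $i$-th coordinate reversed. The process $Y$ on $\Omega_Y=\mathbb{Z}_+^{i-1}\times\mathbb{Z}\times\mathbb{Z}_+^{d-i}$ is: $Y_0=y$; $Y_{k+1}=Y_k+J_k$ if $Y_k+J_k\in\Omega_Y$ and $Y_{k+1}=Y_k$ otherwise. $\tau=\inf\{k:Y_k(i)=\sum_{j\ne i}Y_k(j)\}$. Subscripts on $P$ denote the initial position of the process. *)

(* Defs.v *)
From mathcomp Require Import all_boot all_order all_algebra finmap.
From mathcomp Require Import all_classical all_reals all_analysis.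

Set Implicit Arguments.
Unset Strict Implicit.
Unset Printing Implicit Defensive.

Import Order.TTheory GRing.Theory Num.Theory.
Import numFieldNormedType.Exports.

Local Open Scope classical_set_scope.
Local Open Scope ring_scope.

(* N_0 = {0, ..., d} is 'I_d.+1, with ord0 the outside world; N_+ = {1, ..., d}
   is 'I_d, embedded in N_0 by lift ord0, and 'I_d also indexes the coordinates
   of Z^d. *)
Definition node (d : nat) (j : 'I_d) : 'I_d.+1 := lift ord0 j.

Section Network.
Variables (R : realType) (d : nat) (p : 'M[R]_d.+1).

Definition transition_matrix : Prop :=
  [/\ forall j k, 0 <= p j k,
      forall j, p j j = 0 &
      \sum_j \sum_k p j k = 1].

Definition irreducible_matrix : Prop :=
  forall j k : 'I_d.+1, connect (fun a b => 0 < p a b) j k.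

Definition arrival_rate (j : 'I_d) : R := p ord0 (node j).

Definition service_rate (j : 'I_d) : R := \sum_(k : 'I_d.+1) p (node j) k.

Definition routing (j : 'I_d) (k : 'I_d.+1) : R := p (node j) k / service_rate j.

Definition traffic_equation (nu : 'I_d -> R) : Prop :=
  forall j, nu j = arrival_rate j + \sum_(k : 'I_d) nu k * routing k (node j).

Definition utilization (nu : 'I_d -> R) (j : 'I_d) : R := nu j / service_rate j.

End Network.

Section RandomElements.
Variables (R : realType) (disp : measure_display) (T : measurableType disp).
Variables (P : probability T R) (U : Type) (X : nat -> T -> U).

(* The value space carries the discrete sigma-algebra: every subset of U is an
   event. *)
Definition discrete_random_elements : Prop :=
  forall k (A : set U), measurable (X k @^-1` A).

Definition mutually_independent : Prop :=
  forall (K : {fset nat}) (A : nat -> set U),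
    P (\bigcap_(k in [set` K]) (X k @^-1` A k)) =
    (\prod_(k <- K) P (X k @^-1` A k))%E.

End RandomElements.

Section Walks.
Variable d : nat.
Implicit Types (x y v : 'rV[int]_d) (i j : 'I_d).

(* e_0 = 0, and e_1, ..., e_d are the unit vectors. *)
Definition unit_vec (j : 'I_d.+1) : 'rV[int]_d :=
  if unlift ord0 j is Some k then delta_mx ord0 k else 0.

(* The values e_l - e_j (j <> l) are pairwise distinct and the p j l add up to
   1, so the last clause determines the common law of the I_k. *)
Definition iid_increments (R : realType) (p : 'M[R]_d.+1)
    (disp : measure_display) (T : measurableType disp) (P : probability T R)
    (I : nat -> T -> 'rV[int]_d) : Prop :=
  [/\ discrete_random_elements I,
      mutually_independent P I &
      forall k (j l : 'I_d.+1), j != l ->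
        P (I k @^-1` [set unit_vec l - unit_vec j]) = (p j l)%:E].

Definition orthant : {pred 'rV[int]_d} :=
  [pred x : 'rV[int]_d | [forall j, 0 <= x ord0 j]].

Definition half_orthant i : {pred 'rV[int]_d} :=
  [pred x : 'rV[int]_d | [forall j, (j != i) ==> (0 <= x ord0 j)]].

Fixpoint constrained_walk (D : {pred 'rV[int]_d}) (x : 'rV[int]_d)
    (step : nat -> 'rV[int]_d) (k : nat) : 'rV[int]_d :=
  if k is k'.+1 then
    let z := constrained_walk D x step k' in
    if z + step k' \in D then z + step k' else z
  else x.

Definition flip i v : 'rV[int]_d :=
  \row_j (if j == i then - v ord0 j else v ord0 j).

Definition X_walk (T : Type) (I : nat -> T -> 'rV[int]_d) x (w : T) :
    nat -> 'rV[int]_d :=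
  constrained_walk orthant x (fun k => I k w).

Definition Y_walk i (T : Type) (I : nat -> T -> 'rV[int]_d) y (w : T) :
    nat -> 'rV[int]_d :=
  constrained_walk (half_orthant i) y (fun k => flip i (I k w)).

(* T_n is used both on R^d and on its subset Z^d, hence the arbitrary V. *)
Definition reflect_at (V : zmodType) i (n : V) (x : 'rV[V]_d) : 'rV[V]_d :=
  \row_j (if j == i then n - x ord0 j else x ord0 j).

End Walks.

Section HittingTimes.
Variables (R : realType) (d : nat).
Implicit Types (z : nat -> 'rV[int]_d).

(* inf E, with inf set0 = +oo. *)
Definition first_time (E : set nat) : \bar R := ereal_inf [set k%:R%:E | k in E].

Definition tau_level (n : nat) z : \bar R :=
  first_time [set k | \sum_(j < d) z k ord0 j = n%:Z].

Definition tau_origin z : \bar R := first_time [set k | z k = 0].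

Definition tau_diag (i : 'I_d) z : \bar R :=
  first_time [set k | z k ord0 i = \sum_(j < d | j != i) z k ord0 j].

End HittingTimes.

(* Main.v *)
Require Import Defs.
From mathcomp Require Import all_boot all_order all_algebra finmap.
From mathcomp Require Import all_classical all_reals all_analysis.
From mathcomp Require Import ring lra zify.

Import Order.TTheory GRing.Theory Num.Theory.
Import numFieldNormedType.Exports.
Local Open Scope classical_set_scope.
Local Open Scope ring_scope.

(** All the walks are driven by the same increments.  As long as the i-th queue
of X has not been emptied, X started from T_n(y) is the image under T_n of Y
started from y, and level n for X is the diagonal for Y; this lasts for about n
steps ([reflected_walk]).  Hence the two events can differ for large n only if
X reaches level n after a long time but before the origin, and the whole point
is to exclude that uniformly in n.

Compare X with the walk Z driven by the same increments and started empty.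
The dynamics is monotone: Z stays below X coordinatewise, and the excess of
customers of X over Z never increases ([run_below]).  By irreducibility there
is a finite word w of services, of positive probability, which expels at least
one customer from any nonempty network ([draining_word]).  If Z holds at
most r customers and the next increments spell r+1 copies of w, then Z ends up
empty and the excess has dropped by one, or X is at the origin
([block_drain]).  So, if up to some time there have been h such successes, then
X either has visited the origin or has at most its initial population - h
more customers than Z.  Consequently X stays below level n for ever, up to its
visit to the origin, as soon as the number of successes outgrows the population
of Z ([good_path]).  This last condition speaks of Z and of the increments
only, and not of n: it is the uniformity that is needed.

It remains to see that successes do outgrow the population of Z.  Write rho_j
for the utilization of queue j.  The product of the rho_j ^ x_j is an invariant
weight of the walk and equals 1 at the origin, so by induction on k it bounds
P(Z_k = x) for all k ([product_form_bound]).  Since rho_j < 1, the population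
of Z has an exponential tail, uniformly in time ([population_tail]).  In stage
r, which lasts a time of order r A^r, at least half of the blocks of length
(r+1)|w| therefore start with at most r customers in Z, up to a probability
exponentially small in r, and each of these is a success with probability
eta^(r+1).  With A eta >= 4 this makes it very unlikely to have fewer than H r
successes ([few_successes]), while the population of Z reaches H r - c before
the end of stage r+1 only with exponentially small probability if H is large.
The failure probabilities are thus dominated by a geometric series
([bad_stage_rare]), and almost surely only finitely many stages fail by
Borel-Cantelli ([tail_null]).

Probabilities of events about finitely many increments are computed by
[expect], a finite weighted sum over words of letters (j, l), each letter
standing for the increment e_l - e_j. *)

Set Implicit Arguments.
Unset Strict Implicit.
Unset Printing Implicit Defensive.

(** * Walks on the orthant driven by words *)

Section Network.
Context (d : nat).
Implicit Types (x z : 'rV[int]_d) (i j : 'I_d) (a : 'I_d.+1 * 'I_d.+1).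
Implicit Types (s w : seq ('I_d.+1 * 'I_d.+1)).

Definition hop a : 'rV[int]_d := unit_vec a.2 - unit_vec a.1.

Definition cstep (D : {pred 'rV[int]_d}) z (v : 'rV[int]_d) :=
  if z + v \in D then z + v else z.

Definition run x s := foldl (fun z a => cstep (@orthant d) z (hop a)) x s.

Definition population x : int := \sum_(j < d) x ord0 j.

Lemma constrained_walk_foldl D x step k :
  constrained_walk D x step k = foldl (cstep D) x (mkseq step k).
Proof. by elim: k => [//|k IH]; rewrite mkseqS foldl_rcons -IH. Qed.

Lemma run_constrained_walk x (a : nat -> 'I_d.+1 * 'I_d.+1) k :
  constrained_walk (@orthant d) x (fun t => hop (a t)) k = run x (mkseq a k).
Proof. by elim: k => [//|k IH]; rewrite mkseqS /run foldl_rcons -/(run _ _) -IH. Qed.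

Lemma run_rcons x s a : run x (rcons s a) = cstep (@orthant d) (run x s) (hop a).
Proof. by rewrite /run foldl_rcons. Qed.

Lemma run_cat x s1 s2 : run x (s1 ++ s2) = run (run x s1) s2.
Proof. by rewrite /run foldl_cat. Qed.

Lemma orthantP x : reflect (forall j, 0 <= x ord0 j) (x \in @orthant d).
Proof. by apply: (iffP forallP). Qed.

Lemma orthant0 : 0 \in @orthant d.
Proof. by apply/orthantP => j; rewrite mxE. Qed.

Lemma cstep_in D z v : z \in D -> cstep D z v \in D.
Proof. by rewrite /cstep; case: ifP. Qed.

Lemma run_orthant x s : x \in @orthant d -> run x s \in @orthant d.
Proof. by elim: s x => //= a s IH x xO; apply: IH; apply: cstep_in. Qed.

Lemma unit_vec0 : unit_vec ord0 = 0 :> 'rV[int]_d.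
Proof. by rewrite /unit_vec unlift_none. Qed.

Lemma unit_vec_node i : unit_vec (node i) = delta_mx ord0 i :> 'rV[int]_d.
Proof. by rewrite /unit_vec /node liftK. Qed.

Lemma unit_vec_nodeE i j : unit_vec (node i) ord0 j = (j == i)%:R :> int.
Proof. by rewrite unit_vec_node mxE eqxx. Qed.

Lemma coordD x z j : (x + z) ord0 j = x ord0 j + z ord0 j :> int.
Proof. by rewrite mxE. Qed.

Lemma coordN x j : (- x) ord0 j = - x ord0 j :> int.
Proof. by rewrite mxE. Qed.

Lemma nodeP (b : 'I_d.+1) : b = ord0 \/ exists j, b = node j.
Proof. by case: (unliftP ord0 b) => [j ->|->]; [right; exists j|left]. Qed.

Lemma node_neq0 j : node j != ord0.
Proof. by rewrite eq_sym neq_lift. Qed.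

Lemma node_inj : injective (@node d).
Proof. exact: lift_inj. Qed.

Lemma unit_vec_ge0 (b : 'I_d.+1) j : 0 <= unit_vec b ord0 j :> int.
Proof.
have [->|[i ->]] := nodeP b; first by rewrite unit_vec0 mxE.
by rewrite unit_vec_nodeE.
Qed.

Lemma unit_vec_le1 (b : 'I_d.+1) j : unit_vec b ord0 j <= 1 :> int.
Proof.
have [->|[i ->]] := nodeP b; first by rewrite unit_vec0 mxE.
by rewrite unit_vec_nodeE; case: eqP.
Qed.

Lemma populationD x z : population (x + z) = population x + population z.
Proof. by rewrite /population -big_split; apply: eq_bigr => j _; rewrite mxE. Qed.

Lemma populationN x : population (- x) = - population x.
Proof. by rewrite /population -sumrN; apply: eq_bigr => j _; rewrite mxE. Qed.

Lemma population0 : population 0 = 0.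
Proof. by rewrite /population big1 // => j _; rewrite mxE. Qed.

Lemma population_unit_vec (b : 'I_d.+1) : population (unit_vec b) = (b != ord0)%:R.
Proof.
have [->|[i ->]] := nodeP b; first by rewrite unit_vec0 population0 eqxx.
rewrite node_neq0 /population (bigD1 i) //= unit_vec_nodeE eqxx big1 ?addr0 // => j.
by rewrite unit_vec_nodeE => /negbTE ->.
Qed.

Lemma population_ge0 x : x \in @orthant d -> 0 <= population x.
Proof. by move/orthantP => xO; apply: sumr_ge0 => j _. Qed.

Lemma population_eq0 x : x \in @orthant d -> population x = 0 -> x = 0.
Proof.
move=> /orthantP xO x0; apply/rowP => j; rewrite mxE.
have /psumr_eq0P : forall k, true -> 0 <= x ord0 k by [].
by move=> /(_ x0) ->.
Qed.

Lemma hop_id (b : 'I_d.+1) : hop (b, b) = 0.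
Proof. by rewrite /hop subrr. Qed.

Lemma hop_nodeE i (l : 'I_d.+1) j :
  hop (node i, l) ord0 j = unit_vec l ord0 j - (j == i)%:R.
Proof. by rewrite /hop coordD coordN unit_vec_nodeE. Qed.

Lemma add_arrival_orthant x (l : 'I_d.+1) :
  x \in @orthant d -> x + hop (ord0, l) \in @orthant d.
Proof.
move=> /orthantP xO; apply/orthantP => j.
by rewrite /hop unit_vec0 subr0 mxE addr_ge0 ?unit_vec_ge0.
Qed.

Lemma add_service_orthant x i (l : 'I_d.+1) : x \in @orthant d -> node i != l ->
  (x + hop (node i, l) \in @orthant d) = (0 < x ord0 i).
Proof.
move=> /orthantP xO il; apply/orthantP/idP => [/(_ i)|xi j].
  rewrite coordD hop_nodeE eqxx.
  suff -> : unit_vec l ord0 i = 0 :> int by rewrite sub0r subr_ge0 gtz0_ge1.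
  have [->|[k lk]] := nodeP l; first by rewrite unit_vec0 mxE.
  rewrite lk unit_vec_nodeE; case: eqP => // ik.
  by rewrite lk ik eqxx in il.
rewrite coordD hop_nodeE; have := unit_vec_ge0 l j; have := xO j.
by case: eqP => [->|_]; rewrite natz; lia.
Qed.

Definition below x z := forall j, x ord0 j <= z ord0 j.

(** A service offered to a queue that is empty below but not above moves only
    the upper walk: the order survives because the lower coordinate is 0, and
    the excess decreases exactly if that customer leaves the network. *)
Lemma cstep_below x z a : x \in @orthant d -> z \in @orthant d -> below x z ->
  below (cstep (@orthant d) x (hop a)) (cstep (@orthant d) z (hop a)) /\
  population (cstep (@orthant d) z (hop a)) - population (cstep (@orthant d) x (hop a))
    <= population z - population x.
Proof.
move=> xO zO xz; case: a => b l.
have both : below (x + hop (b, l)) (z + hop (b, l)) /\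
   population (z + hop (b, l)) - population (x + hop (b, l)) <= population z - population x.
  by split=> [j|]; [rewrite !coordD lerD2r|rewrite !populationD; lia].
have [b0|[i bi]] := nodeP b; first by rewrite /cstep b0 !add_arrival_orthant // -b0.
have [bl|bl] := eqVneq b l; first by rewrite /cstep bl hop_id !addr0 xO zO; split.
rewrite /cstep bi !add_service_orthant -?bi //.
have := xz i; have := orthantP _ xO i => xi0 xzi.
case: ifPn => xi; case: ifPn => zi.
- by [].
- by exfalso; lia.
- rewrite populationD /hop populationD populationN !population_unit_vec bi node_neq0.
  split; last by case: (l != ord0); lia.
  move=> j; rewrite coordD hop_nodeE; have := xz j; have := unit_vec_ge0 l j.
  by case: eqP => [->|_]; rewrite natz; lia.
- by split.
Qed.

Lemma run_below x z s : x \in @orthant d -> z \in @orthant d -> below x z ->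
  below (run x s) (run z s) /\
  population (run z s) - population (run x s) <= population z - population x.
Proof.
elim: s x z => [|a s IH] x z xO zO xz //=.
have [b1 t1] := cstep_below a xO zO xz.
have [b2 t2] := IH _ _ (cstep_in _ xO) (cstep_in _ zO) b1.
by split=> //; apply: le_trans t2 t1.
Qed.

(** The word follows one customer along a path from queue j to the exit.  The
    first disjunction is what makes such words composable: a customer moved at
    some step is also moved at all later ones, since each service is offered to
    the queue just joined; so a path word does nothing or expels somebody. *)
Lemma path_drain (e : rel 'I_d.+1) j t :
  (forall b, ~~ e b b) -> path e (node j) t -> last (node j) t = ord0 ->
  exists w, [/\ all (fun a => e a.1 a.2) w, run 0 w = 0 &
    forall x, x \in @orthant d ->
     (run x w = x \/ population (run x w) < population x) /\
     (0 < x ord0 j -> population (run x w) < population x)].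
Proof.
move=> e_irr; elim: t j => [|l t IH] j /=.
  by move=> _ /eqP; rewrite (negbTE (node_neq0 j)).
case/andP => ejl pt lt.
have jl : node j != l by apply: contraTneq ejl => <-; exact: e_irr.
have blocked x : x \in @orthant d -> ~~ (0 < x ord0 j) ->
    cstep (@orthant d) x (hop (node j, l)) = x.
  by move=> xO xj; rewrite /cstep add_service_orthant // (negbTE xj).
have [l0|[k lk]] := nodeP l.
  exists [:: (node j, l)]; split=> /=; first by rewrite ejl.
    by apply: blocked; [exact: orthant0|rewrite mxE].
  move=> x xO; case: (boolP (0 < x ord0 j)) => xj; last by rewrite blocked //; split; [left|].
  rewrite /cstep add_service_orthant // xj populationD /hop populationD populationN.
  by rewrite !population_unit_vec l0 node_neq0 eqxx; split; [right|]; lia.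
have pt' : path e (node k) t by rewrite -lk.
have lt' : last (node k) t = ord0 by rewrite -lk.
have [w [ew w0 wx]] := IH k pt' lt'.
exists ((node j, l) :: w); split=> /=; first by rewrite ejl.
  by rewrite blocked ?w0 ?orthant0 // mxE.
move=> x xO; case: (boolP (0 < x ord0 j)) => xj; last first.
  by rewrite blocked //; split=> //; case: (wx x xO).
have tx : population (x + hop (node j, l)) = population x.
  by rewrite populationD /hop populationD populationN !population_unit_vec lk !node_neq0; lia.
have x1O : x + hop (node j, l) \in @orthant d by rewrite add_service_orthant.
rewrite /cstep x1O.
have [_] := wx _ x1O.
rewrite tx coordD hop_nodeE lk unit_vec_nodeE eqxx.
have -> : (k == j) = false by apply/negbTE; apply: contraNneq jl => <-; rewrite lk.
have := orthantP _ xO k => xk /(_ ltac:(lia)) h.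
by split; [right|].
Qed.

(** Concatenating the path words of all queues works although each of them may
    displace customers, because a path word that moves anybody already lowers
    the population. *)
Lemma draining_word (e : rel 'I_d.+1) :
  (forall b, ~~ e b b) -> (forall b c, connect e b c) ->
  exists w, [/\ all (fun a => e a.1 a.2) w, run 0 w = 0 &
    forall x, x \in @orthant d -> x != 0 -> population (run x w) < population x].
Proof.
move=> e_irr e_conn.
suff [w [ew w0 wx]] : exists w, [/\ all (fun a => e a.1 a.2) w, run 0 w = 0 &
    forall x, x \in @orthant d ->
     (run x w = x \/ population (run x w) < population x) /\
     forall j, j \in enum 'I_d -> 0 < x ord0 j -> population (run x w) < population x].
  exists w; split=> // x xO x0; have [_ wxj] := wx x xO.
  have [j xj] : exists j, 0 < x ord0 j.
    apply/existsP; apply: contraNT x0; rewrite negb_exists => /forallP x0.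
    apply/eqP/rowP => j; rewrite [RHS]mxE.
    by have := x0 j; have := orthantP _ xO j; case: ltgtP.
  by apply: wxj xj; rewrite mem_enum.
elim: (enum 'I_d) => [|j js [w [ew w0 wx]]].
  by exists [::]; split=> // x xO; split; [left|].
have /connectP [t pt lt] := e_conn (node j) ord0.
have [w' [ew' w0' wx']] := path_drain e_irr pt (esym lt).
exists (w' ++ w); split; first by rewrite all_cat ew'.
  by rewrite run_cat w0'.
move=> x xO; have [one onej] := wx' x xO.
have [two twoj] := wx _ (run_orthant w' xO).
rewrite run_cat; split.
  case: one two => [->|lt1] [->|lt2]; [by left|by right|by right|right].
  exact: lt_trans lt2 lt1.
move=> k; rewrite inE => /orP[/eqP ->|kjs] xk.
  have lt1 := onej xk.
  by case: two => [->//|lt2]; exact: lt_trans lt2 lt1.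
case: one => [runx|lt1]; first by move: twoj; rewrite runx => /(_ k kjs xk).
by case: two => [->//|lt2]; exact: lt_trans lt2 lt1.
Qed.

Section Blocks.
Variable w : seq ('I_d.+1 * 'I_d.+1).
Hypothesis w0 : run 0 w = 0.
Hypothesis w_drains :
  forall x, x \in @orthant d -> x != 0 -> population (run x w) < population x.

Definition wpow r := flatten (nseq r w).

Lemma size_wpow r : size (wpow r) = (r * size w)%N.
Proof. by rewrite /wpow size_flatten /shape map_nseq sumn_nseq mulnC. Qed.

Lemma wpowS r : wpow r.+1 = wpow r ++ w.
Proof.
elim: r => [|r IH]; first by rewrite /wpow /= ?cats0.
have -> : wpow r.+2 = w ++ wpow r.+1 by [].
by rewrite {1}IH catA.
Qed.

(** Each copy of w expels a customer as long as there is one, and none enters. *)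
Lemma run_wpow x r : x \in @orthant d -> population x <= r%:Z -> run x (wpow r) = 0.
Proof.
elim: r x => [|r IH] x xO xr /=.
  by apply: population_eq0 => //; have := population_ge0 xO; lia.
rewrite /wpow /= run_cat; apply: IH; first exact: run_orthant.
have [->|x0] := eqVneq x 0; first by rewrite w0 population0.
have := w_drains xO x0; lia.
Qed.

(** The first r copies of w empty the lower walk without increasing the excess;
    during the last copy the lower walk is idle, so what w drains from the upper
    walk is excess. *)
Lemma block_drain x z r : x \in @orthant d -> z \in @orthant d -> below x z ->
  population x <= r%:Z ->
  run x (wpow r.+1) = 0 /\
  (run z (wpow r.+1) = 0 \/
   population (run z (wpow r.+1)) <= population z - population x - 1).
Proof.
move=> xO zO xz xr; rewrite wpowS !run_cat (run_wpow xO xr) w0; split=> //.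
have [_] := run_below (wpow r) xO zO xz; rewrite (run_wpow xO xr) population0 subr0 => tz.
have [->|z0] := eqVneq (run z (wpow r)) 0; first by left; rewrite w0.
by right; have := w_drains (run_orthant _ zO) z0; lia.
Qed.

(** Block b of stage r consists of the letters from position b (r+1)|w| on. *)
Definition calm r s b := population (run 0 (take (b * (r.+1 * size w)) s)) <= r%:Z.

Definition success r s b := calm r s b &&
  (take (r.+1 * size w) (drop (b * (r.+1 * size w)) s) == wpow r.+1).

(** The alternative is needed because a success lowers the excess only if the
    upper walk is not empty; at the end of a successful block without excess
    both walks are at the origin. *)
Lemma drained_after_blocks z r s B : z \in @orthant d ->
  (exists2 t, (t <= B * (r.+1 * size w))%N & run z (take t s) = 0) \/
  population (run z (take (B * (r.+1 * size w)) s))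
   - population (run 0 (take (B * (r.+1 * size w)) s)) <=
  population z - (\sum_(b < B) success r s b)%:Z.
Proof.
move=> zO; set l := (r.+1 * size w)%N.
elim: B => [|B [[t tB zt]|IH]].
- by right; rewrite mul0n take0 big_ord0 /= population0; lia.
- by left; exists t => //; apply: leq_trans tB _; rewrite leq_mul2r leqnSn orbT.
have split_take : take (B.+1 * l) s = take (B * l) s ++ take l (drop (B * l) s).
  by rewrite mulSn addnC takeD.
have O0 := orthant0.
have b0 : below 0 z by move=> j; rewrite mxE; apply/orthantP.
have [b1 t1] := run_below (take (B * l) s) O0 zO b0.
rewrite big_ord_recr /= split_take !run_cat.
have xO1 := run_orthant (take (B * l) s) O0.
have zO1 := run_orthant (take (B * l) s) zO.
case: (boolP (success r s B)) => [/andP[calmB /eqP blockB]|_]; last first.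
  by right; rewrite addn0; apply: le_trans IH; case: (run_below (take l (drop (B * l) s)) xO1 zO1 b1).
rewrite /calm -/l in calmB; rewrite -/l in blockB.
have [x_end [z_end|z_end]] := block_drain xO1 zO1 b1 calmB.
  by left; exists (B.+1 * l)%N => //; rewrite split_take run_cat blockB.
right; rewrite blockB x_end population0 subr0 PoszD opprD addrA.
by apply: le_trans z_end _; rewrite lerD2r.
Qed.

End Blocks.
End Network.

(** * The traffic equation *)

Section Traffic.
Context (R : realType) (d : nat) (p : 'M[R]_d.+1) (nu : 'I_d -> R).
Hypothesis p_transition : transition_matrix p.
Hypothesis p_irreducible : irreducible_matrix p.
Hypothesis nu_traffic : traffic_equation p nu.

Lemma transition_ge0 j k : 0 <= p j k. Proof. by case: p_transition. Qed.

Lemma transition_diag j : p j j = 0. Proof. by case: p_transition. Qed.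

Lemma service_rate_gt0 j : 0 < service_rate p j.
Proof.
have /connectP [[|l t]] := p_irreducible (node j) ord0.
  by move=> _ /= /eqP; rewrite eq_sym (negbTE (node_neq0 j)).
move=> /= /andP[pjl _] _; rewrite /service_rate (bigD1 l) //=.
by apply: ltr_wpDr => //; apply: sumr_ge0 => k _; exact: transition_ge0.
Qed.

Lemma routing_ge0 j k : 0 <= routing p j k.
Proof. by rewrite divr_ge0 ?transition_ge0 // ltW ?service_rate_gt0. Qed.

Lemma routing_sum j : \sum_(k : 'I_d) routing p j (node k) = 1 - routing p j ord0.
Proof.
have : \sum_k routing p j k = 1.
  by rewrite -mulr_suml divff // gt_eqF // service_rate_gt0.
by rewrite big_ord_recl /= => <-; rewrite addrC addKr.
Qed.

(** Summing the traffic equation shows that the negative part m of nu satisfies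
    m_j = sum_k m_k r(k,j) with no mass ever routed to the exit.  Positivity of m
    would propagate along edges, hence reach the outside world by
    irreducibility, which is absurd. *)
Lemma traffic_ge0 j : 0 <= nu j.
Proof.
pose m k := Num.max (- nu k) 0.
have m0 k : 0 <= m k by rewrite le_max lexx orbT.
have m_sub k : m k <= \sum_l m l * routing p l (node k).
  rewrite ge_max sumr_ge0 ?andbT => [|l _]; last by rewrite mulr_ge0 ?routing_ge0.
  rewrite nu_traffic opprD -sumrN.
  apply: (@le_trans _ _ (\sum_l - (nu l * routing p l (node k)))).
    by rewrite gerDr oppr_le0 transition_ge0.
  apply: ler_sum => l _; rewrite -mulNr ler_wpM2r ?routing_ge0 //.
  by rewrite le_max lexx.
have swap : \sum_k \sum_l m l * routing p l (node k) =
            \sum_l m l - \sum_l m l * routing p l ord0.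
  rewrite exchange_big /= -sumrB; apply: eq_bigr => l _.
  by rewrite -mulr_sumr routing_sum mulrBr mulr1.
have out_ge0 l : true -> 0 <= m l * routing p l ord0.
  by move=> _; rewrite mulr_ge0 ?routing_ge0.
have out0 : \sum_l m l * routing p l ord0 = 0.
  apply/eqP; rewrite eq_le sumr_ge0 // andbT.
  have : \sum_k m k <= \sum_k \sum_l m l * routing p l (node k) by apply: ler_sum.
  by rewrite swap; lra.
have gap_ge0 k : true -> 0 <= \sum_l m l * routing p l (node k) - m k.
  by move=> _; rewrite subr_ge0.
have gap0 : \sum_k (\sum_l m l * routing p l (node k) - m k) = 0.
  by rewrite sumrB swap out0; lra.
have m_eq k : m k = \sum_l m l * routing p l (node k).
  by have /(_ k isT) := psumr_eq0P gap_ge0 gap0; lra.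
have {}out0 l : m l * routing p l ord0 = 0 by apply: (psumr_eq0P out_ge0 out0).
have spread k b : 0 < m k -> 0 < p (node k) b -> exists2 l, b = node l & 0 < m l.
  move=> mk pkb.
  have rkb : 0 < routing p k b by rewrite divr_gt0 // service_rate_gt0.
  have [b0|[l bl]] := nodeP b.
    by have := out0 k; rewrite -b0 => /eqP; rewrite gt_eqF // mulr_gt0.
  exists l => //; rewrite m_eq (bigD1 k) //= ltr_wpDr //.
    by apply: sumr_ge0 => l' _; rewrite mulr_ge0 ?routing_ge0.
  by rewrite mulr_gt0 // -bl.
suff : m j <= 0 by rewrite ge_max lexx andbT oppr_le0.
rewrite leNgt; apply/negP => mj.
have /connectP [t pt lt] := p_irreducible (node j) ord0.
elim: t j mj pt lt => [|b t IH] j mj /=.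
  by move=> _ /eqP; rewrite eq_sym (negbTE (node_neq0 j)).
case/andP => pjb pt lt; have [l bl ml] := spread _ _ mj pjb.
by apply: (IH l ml); rewrite -bl.
Qed.

Lemma utilization_ge0 j : 0 <= utilization p nu j.
Proof. by rewrite divr_ge0 ?traffic_ge0 // ltW ?service_rate_gt0. Qed.

(** Extends rho to the outside world by rho_0 = 1; then the traffic equation and
    the conservation of customers become balance equations for p itself. *)
Definition load (b : 'I_d.+1) : R :=
  if unlift ord0 b is Some j then utilization p nu j else 1.

Lemma load0 : load ord0 = 1. Proof. by rewrite /load unlift_none. Qed.

Lemma load_node j : load (node j) = utilization p nu j.
Proof. by rewrite /load /node liftK. Qed.

Lemma load_flow k (b : 'I_d.+1) :
  load (node k) * p (node k) b = nu k * routing p k b.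
Proof. by rewrite load_node /utilization /routing -!mulrA [_^-1 * _]mulrC. Qed.

Lemma load_balance l :
  \sum_b load b * p b (node l) = utilization p nu l * service_rate p l.
Proof.
rewrite big_ord_recl load0 mul1r.
under eq_bigr do rewrite load_flow.
by rewrite divfK ?gt_eqF ?service_rate_gt0 // [RHS]nu_traffic.
Qed.

Lemma load_outflow : \sum_b load b * p b ord0 = \sum_l p ord0 l.
Proof.
rewrite big_ord_recl transition_diag mulr0 add0r big_ord_recl transition_diag add0r.
under eq_bigr do rewrite load_flow.
have : \sum_j nu j = \sum_j (arrival_rate p j +
    \sum_(k : 'I_d) nu k * routing p k (node j)).
  by apply: eq_bigr => j _; exact: nu_traffic.
rewrite big_split exchange_big /=.
under [X in _ = _ + X]eq_bigr do rewrite -mulr_sumr routing_sum mulrBr mulr1.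
by rewrite sumrB => e; rewrite -[RHS]/(\sum_j arrival_rate p j); lra.
Qed.

End Traffic.

(** * Words with independent letters *)

Section Words.
Context (R : realType) (d : nat) (p : 'M[R]_d.+1).
Hypothesis p_transition : transition_matrix p.
Local Notation letter := ('I_d.+1 * 'I_d.+1)%type.
Implicit Types (s u v : seq letter) (f g : seq letter -> R).

Definition weight (a : letter) : R := p a.1 a.2.

Lemma weight_ge0 a : 0 <= weight a. Proof. exact: transition_ge0. Qed.

Lemma weight_sum : \sum_a weight a = 1.
Proof.
by case: p_transition => _ _ <-; rewrite pair_big.
Qed.

Fixpoint expect k f : R :=
  if k is k'.+1 then \sum_a weight a * expect k' (fun s => f (a :: s))
  else f [::].

Lemma expect_le k f g : (forall s, size s = k -> f s <= g s) ->
  expect k f <= expect k g.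
Proof.
elim: k f g => [|k IH] f g fg /=; first exact: fg.
apply: ler_sum => a _; rewrite ler_wpM2l ?weight_ge0 //.
by apply: IH => s sk; apply: fg; rewrite /= sk.
Qed.

Lemma eq_expect k f g : (forall s, size s = k -> f s = g s) ->
  expect k f = expect k g.
Proof.
elim: k f g => [|k IH] f g fg /=; first exact: fg.
by apply: eq_bigr => a _; congr (_ * _); apply: IH => s sk; apply: fg; rewrite /= sk.
Qed.

Lemma expect_cst k (c : R) : expect k (fun=> c) = c.
Proof. by elim: k => //= k IH; rewrite IH -mulr_suml weight_sum mul1r. Qed.

Lemma expectZ k (c : R) f : expect k (fun s => c * f s) = c * expect k f.
Proof.
elim: k f => //= k IH f; rewrite mulr_sumr; apply: eq_bigr => a _.
by rewrite IH mulrCA.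
Qed.

Lemma expectD k f g :
  expect k (fun s => f s + g s) = expect k f + expect k g.
Proof.
elim: k f g => //= k IH f g; rewrite -big_split; apply: eq_bigr => a _ /=.
by rewrite IH mulrDr.
Qed.

Lemma expect_sum (J : Type) (r : seq J) k (F : J -> seq letter -> R) :
  expect k (fun s => \sum_(j <- r) F j s) = \sum_(j <- r) expect k (F j).
Proof.
elim: r => [|j r IH]; first by rewrite big_nil -{2}(expect_cst k 0); apply: eq_expect => s _; rewrite big_nil.
rewrite big_cons -IH -expectD; apply: eq_expect => s _.
by rewrite big_cons.
Qed.

Lemma expect_cat k m f :
  expect (k + m) f = expect k (fun s => expect m (fun s' => f (s ++ s'))).
Proof.
elim: k f => [|k IH] f /=; first by apply: eq_expect.
by apply: eq_bigr => a _; rewrite IH.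
Qed.

Lemma expectS_rcons k f :
  expect k.+1 f = expect k (fun s => \sum_a weight a * f (rcons s a)).
Proof.
rewrite -addn1 expect_cat; apply: eq_expect => s _ /=.
by apply: eq_bigr => a _; rewrite cats1.
Qed.

Lemma expect_take k m f : (k <= m)%N ->
  expect m (fun s => f (take k s)) = expect k f.
Proof.
move=> km; rewrite -(subnKC km) expect_cat; apply: eq_expect => s sk.
rewrite -[RHS](expect_cst (m - k)); apply: eq_expect => s' _.
by rewrite take_size_cat.
Qed.

Lemma expect_word u : expect (size u) (fun s => (s == u)%:R) = \prod_(a <- u) weight a.
Proof.
elim: u => [|a u IH] /=; first by rewrite big_nil.
rewrite big_cons -IH (bigD1 a) //= big1 ?addr0 => [|b ba].
  by congr (_ * _); apply: eq_expect => s _; rewrite eqseq_cons eqxx.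
rewrite (_ : expect _ _ = 0) ?mulr0 // -[RHS](expect_cst (size u)).
by apply: eq_expect => s _; rewrite eqseq_cons (negbTE ba).
Qed.

End Words.

(** * The product-form bound on the empty walk *)

Section ProductForm.
Context (R : realType) (d : nat) (p : 'M[R]_d.+1) (nu : 'I_d -> R).
Hypothesis p_transition : transition_matrix p.
Hypothesis p_irreducible : irreducible_matrix p.
Hypothesis nu_traffic : traffic_equation p nu.
Implicit Types (x z : 'rV[int]_d).

Local Notation rho := (utilization p nu).

Definition busy x (j : 'I_d) : bool := 0 < x ord0 j.

Definition product_form x : R := \prod_j rho j ^+ `|x ord0 j|%N.

Lemma product_form_ge0 x : 0 <= product_form x.
Proof. by apply: prodr_ge0 => j _; rewrite exprn_ge0 // utilization_ge0. Qed.

(** Stated as a multiplication by rho, never as a division, so that it also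
    covers queues of utilization zero. *)
Lemma product_form_add x (b : 'I_d.+1) : x \in @orthant d ->
  product_form (x + unit_vec b) = load p nu b * product_form x.
Proof.
move=> /orthantP xO; have [->|[i ->]] := nodeP b.
  by rewrite unit_vec0 addr0 load0 mul1r.
rewrite load_node /product_form (bigD1 i) //= [in RHS](bigD1 i) //= mulrA.
congr (_ * _); last first.
  apply: eq_bigr => j ji; rewrite coordD unit_vec_nodeE (negbTE ji).
  by rewrite [false%:R]/(0 : int) addr0.
rewrite coordD unit_vec_nodeE eqxx -exprS; congr (_ ^+ _).
by have := xO i; rewrite natz; lia.
Qed.

Lemma cstep_preimage x z v : x \in @orthant d -> z \in @orthant d ->
  (cstep (@orthant d) z v == x)%:R <=
  (x - v \in @orthant d)%:R * (z == x - v)%:R +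
  (x + v \notin @orthant d)%:R * (z == x)%:R :> R.
Proof.
move=> xO zO; rewrite /cstep; case: ifPn => zv.
  have [<-|_] := eqVneq (z + v) x; last by rewrite addr_ge0 ?mulr_ge0.
  by rewrite addrK zO eqxx mul1r lerDl mulr_ge0.
have [<-|_] := eqVneq z x; last by rewrite addr_ge0 ?mulr_ge0.
by rewrite zv mul1r lerDr mulr_ge0.
Qed.

(** Predecessors of x through a letter ending in l, weighted by the product
    form: for a queue l they require x_l > 0, and the traffic equation at l turns
    their sum into the service rate of l. *)
Lemma inflow_balance x (l : 'I_d.+1) : x \in @orthant d ->
  \sum_j p j l * ((x - hop (j, l) \in @orthant d)%:R * product_form (x - hop (j, l)))
  = (if unlift ord0 l is Some k then (busy x k)%:R * service_rate p k
     else \sum_k p ord0 k) * product_form x.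
Proof.
move=> xO; have [->|[k ->]] := nodeP l.
  rewrite unlift_none -(load_outflow p_transition p_irreducible nu_traffic) mulr_suml; apply: eq_bigr => j _.
  rewrite /hop /= unit_vec0 sub0r opprK product_form_add //.
  have -> : x + unit_vec j \in @orthant d.
    by apply/orthantP => i; rewrite coordD addr_ge0 ?unit_vec_ge0 //; exact: orthantP.
  by rewrite mul1r mulrA [p _ _ * _]mulrC.
rewrite {2}/node liftK /busy; case: ltP => xk; last first.
  rewrite !mul0r big1 // => j _.
  have [->|jk] := eqVneq j (node k); first by rewrite transition_diag // mul0r.
  have -> : (x - hop (j, node k) \in @orthant d) = false.
    apply/negbTE/negP => /orthantP /(_ k).
    rewrite coordD coordN /hop coordD coordN unit_vec_nodeE eqxx.
    have -> : unit_vec j ord0 k = 0 :> int.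
      have [->|[i ji]] := nodeP j; first by rewrite unit_vec0 mxE.
      rewrite ji unit_vec_nodeE; case: eqP => // ki.
      by rewrite ji ki eqxx in jk.
    by rewrite natz; lia.
  by rewrite mul0r mulr0.
have x1O : x - unit_vec (node k) \in @orthant d.
  apply/orthantP => j; rewrite coordD coordN unit_vec_nodeE.
  by have := orthantP _ xO j; case: eqP => [->|_]; rewrite natz; lia.
have xE : product_form x = rho k * product_form (x - unit_vec (node k)).
  by rewrite -(load_node p nu) -product_form_add // subrK.
rewrite mul1r xE mulrA [_ * rho k]mulrC -(load_balance p_transition p_irreducible nu_traffic) mulr_suml.
apply: eq_bigr => j _.
have -> : x - hop (j, node k) = x - unit_vec (node k) + unit_vec j.
  by rewrite /hop /= opprB addrCA addrC.
have -> : x - unit_vec (node k) + unit_vec j \in @orthant d.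
  by apply/orthantP => i; rewrite coordD addr_ge0 ?unit_vec_ge0 //; exact: orthantP.
by rewrite product_form_add // mul1r mulrA [p _ _ * _]mulrC.
Qed.

(** Blocked services of empty queues leave x unchanged; they supply the service
    rates that [inflow_balance] misses. *)
Lemma blocked_balance x (j : 'I_d.+1) : x \in @orthant d ->
  \sum_l p j l * (x + hop (j, l) \notin @orthant d)%:R
  = if unlift ord0 j is Some k then (~~ busy x k)%:R * service_rate p k
    else 0.
Proof.
move=> xO; have [->|[k ->]] := nodeP j.
  by rewrite unlift_none big1 // => l _; rewrite add_arrival_orthant // mulr0.
rewrite {2}/node liftK /service_rate mulr_sumr; apply: eq_bigr => l _.
have [<-|kl] := eqVneq (node k) l; first by rewrite transition_diag // !(mul0r, mulr0).
by rewrite add_service_orthant // mulrC.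
Qed.

(** Invariance of the product form: busy queues contribute through arrivals from
    a predecessor, empty ones through blocked services, so together all the
    rates of p appear, and these add up to 1. *)
Lemma product_form_invariant x : x \in @orthant d ->
  \sum_a weight p a *
     ((x - hop a \in @orthant d)%:R * product_form (x - hop a) +
      (x + hop a \notin @orthant d)%:R * product_form x) = product_form x.
Proof.
move=> xO; under eq_bigr do rewrite mulrDr mulrA.
rewrite big_split /=.
have -> : \sum_a weight p a * (x - hop a \in @orthant d)%:R * product_form (x - hop a)
  = \sum_l \sum_j p j l * ((x - hop (j, l) \in @orthant d)%:R * product_form (x - hop (j, l))).
  rewrite exchange_big pair_big /=; apply: eq_bigr => -[j l] _.
  by rewrite mulrA.
have -> : \sum_a weight p a * ((x + hop a \notin @orthant d)%:R * product_form x)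
  = (\sum_j \sum_l p j l * (x + hop (j, l) \notin @orthant d)%:R) * product_form x.
  rewrite pair_big /= mulr_suml; apply: eq_bigr => -[j l] _.
  by rewrite mulrA.
under eq_bigr do rewrite inflow_balance //.
under [X in _ + X * _]eq_bigr do rewrite blocked_balance //.
rewrite -mulr_suml -mulrDl [X in (X + _) * _]big_ord_recl [X in (_ + X) * _]big_ord_recl.
rewrite unlift_none add0r -addrA -big_split /=.
rewrite -[RHS]mul1r; congr (_ * _).
transitivity (\sum_j \sum_k p j k); last by case: p_transition.
rewrite [RHS]big_ord_recl; congr (_ + _).
apply: eq_bigr => j _; rewrite liftK -mulrDl -[RHS]mul1r; congr (_ * _).
by case: (busy _ _); rewrite ?addr0 ?add0r.
Qed.

(** The invariant weight is 1 at the starting point, hence dominates the initial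
    law; domination by an invariant weight is preserved by each step. *)
Lemma product_form_bound k x : x \in @orthant d ->
  expect p k (fun s => (run 0 s == x)%:R) <= product_form x.
Proof.
elim: k x => [|k IH] x xO.
  rewrite /=; have [<-|_] := eqVneq 0 x; last exact: product_form_ge0.
  by rewrite /product_form big1 // => j _; rewrite mxE expr0.
rewrite expectS_rcons -[X in _ <= X]product_form_invariant //.
pose F z a : R := (x - hop a \in @orthant d)%:R * (z == x - hop a)%:R +
  (x + hop a \notin @orthant d)%:R * (z == x)%:R.
apply: (@le_trans _ _ (expect p k (fun s => \sum_a weight p a * F (run 0 s) a))).
  apply: expect_le => // s _; apply: ler_sum => a _.
  rewrite ler_wpM2l ?weight_ge0 // run_rcons cstep_preimage // run_orthant //.
  exact: orthant0.
rewrite expect_sum //; apply: ler_sum => a _.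
rewrite expectZ ler_wpM2l ?weight_ge0 // expectD !expectZ lerD //.
  by case: (boolP (_ \in _)) => xa; rewrite ?mul0r ?mul1r //; exact: IH.
by rewrite ler_wpM2l // IH.
Qed.

Lemma geometric_le (y : R) n : 0 <= y -> y < 1 ->
  \sum_(t < n) y ^+ t <= (1 - y)^-1.
Proof.
move=> y0 y1; have y1' : 0 < 1 - y by rewrite subr_gt0.
rewrite -[X in _ <= X]mul1r ler_pdivlMr //.
have -> : (\sum_(t < n) y ^+ t) * (1 - y) = 1 - y ^+ n.
  by rewrite mulrC -opprB mulNr -subrX1 opprB.
by rewrite gerBl exprn_ge0.
Qed.

Lemma coord_le_population x j : x \in @orthant d -> x ord0 j <= population x.
Proof.
move=> /orthantP xO; rewrite /population (bigD1 j) //= lerDl.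
by apply: sumr_ge0.
Qed.

Lemma run_population_le s x : population (run x s) <= population x + (size s)%:Z.
Proof.
elim: s x => [|a s IH] x /=; first by rewrite addr0.
apply: le_trans (IH _) _; rewrite /cstep; case: ifP => _; last by lia.
rewrite populationD /hop populationD populationN !population_unit_vec.
by case: (_ != _); case: (_ != _); rewrite !natz; lia.
Qed.

Variable beta : R.
Hypothesis beta_gt1 : 1 < beta.
Hypothesis beta_rho : forall j, rho j * beta < 1.

Definition tail_const : R := \prod_j (1 - rho j * beta)^-1.

Lemma tail_const_ge0 : 0 <= tail_const.
Proof. by apply: prodr_ge0 => j _; rewrite invr_ge0 subr_ge0 ltW. Qed.

(** Summing beta^|x| against the product form factorizes into geometric series. *)
Lemma expect_exp_population k :
  expect p k (fun s => beta ^+ `|population (run 0 s)|) <= tail_const.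
Proof.
have beta0 : 0 <= beta by apply: le_trans (ltW beta_gt1).
(* In k steps from the origin no coordinate exceeds k, so the box [0, k]^d suffices. *)
pose vec (g : {ffun 'I_d -> 'I_k.+1}) : 'rV[int]_d := \row_j (g j : nat)%:Z.
have vecE g j : vec g ord0 j = (g j : nat)%:Z by rewrite mxE.
have vecO g : vec g \in @orthant d by apply/orthantP => j; rewrite vecE.
have popvec g : `|population (vec g)|%N = (\sum_j g j)%N.
  rewrite /population (eq_bigr (fun j => (g j : nat)%:Z)) => [|j _]; last exact: vecE.
  by rewrite -[in RHS](absz_nat (\sum_j g j)) -(big_morph Posz PoszD (erefl 0%:Z)).
pose F (g : {ffun 'I_d -> 'I_k.+1}) s : R := beta ^+ (\sum_j g j) * (run 0 s == vec g)%:R.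
have boxed : expect p k (fun s => beta ^+ `|population (run 0 s)|) <=
    expect p k (fun s => \sum_g F g s).
  apply: expect_le => // s sk.
  have xO := run_orthant s (@orthant0 d).
  have xk j : (`|run 0 s ord0 j| < k.+1)%N.
    have := coord_le_population j xO; have := run_population_le s 0; rewrite population0 sk.
    by have := orthantP _ xO j; lia.
  pose g : {ffun 'I_d -> 'I_k.+1} := [ffun j => Ordinal (xk j)].
  have runE : run 0 s = vec g.
    apply/rowP => j; rewrite vecE ffunE /= gez0_abs //.
    exact: (orthantP _ xO).
  rewrite (bigD1 g) //= {1}/F -runE eqxx mulr1 -popvec runE lerDl.
  by apply: sumr_ge0 => g' _; rewrite /F mulr_ge0 // exprn_ge0.
apply: le_trans boxed _; rewrite expect_sum //.
apply: (@le_trans _ _ (\sum_(g : {ffun 'I_d -> 'I_k.+1}) \prod_j (rho j * beta) ^+ g j)).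
  apply: ler_sum => g _; rewrite /F expectZ.
  apply: (@le_trans _ _ (beta ^+ (\sum_j g j) * product_form (vec g))).
    by rewrite ler_wpM2l ?exprn_ge0 // product_form_bound.
  rewrite /product_form -prodrXr -big_split /= le_eqVlt; apply/orP; left; apply/eqP.
  by apply: eq_bigr => j _; rewrite vecE absz_nat [RHS]exprMn mulrC.
rewrite -(bigA_distr_bigA (fun j (t : 'I_k.+1) => (rho j * beta) ^+ t)) /=.
apply: ler_prod => j _.
have rb0 : 0 <= rho j * beta by rewrite mulr_ge0 ?utilization_ge0.
rewrite geometric_le ?andbT //.
by apply: sumr_ge0 => t _; rewrite exprn_ge0.
Qed.

Lemma population_tail k a :
  expect p k (fun s => (a%:Z <= population (run 0 s))%R%:R) <= tail_const * beta ^- a.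
Proof.
have beta0 : 0 < beta by apply: lt_trans beta_gt1.
have bound : expect p k (fun s => (a%:Z <= population (run 0 s))%R%:R) <=
    expect p k (fun s => beta ^- a * beta ^+ `|population (run 0 s)|).
  apply: expect_le => // s _; case: (boolP (a%:Z <= population (run 0 s))) => h.
    rewrite mulrC ler_pdivlMr ?exprn_gt0 // mul1r ler_weXn2l ?ltW //; lia.
  by rewrite mulr_ge0 ?invr_ge0 ?exprn_ge0 // ltW.
apply: le_trans bound _.
rewrite expectZ mulrC ler_wpM2r ?invr_ge0 ?exprn_ge0 ?(ltW beta0) //.
exact: expect_exp_population.
Qed.

End ProductForm.

(** * Stages: successes of the draining word against the tail of the empty walk *)

Lemma bernoulli_le (R : realType) (x : R) n : -1 <= x -> 1 + x *+ n <= (1 + x) ^+ n.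
Proof.
move=> x1; elim: n => [|n IH]; first by rewrite mulr0n addr0 expr0.
rewrite exprS; apply: (@le_trans _ _ ((1 + x) * (1 + x *+ n))); last first.
  by rewrite ler_wpM2l // -lerBlDl sub0r.
rewrite -subr_ge0 -[x *+ n]mulr_natl -[x *+ n.+1]mulr_natl -natr1.
have -> : (1 + x) * (1 + n%:R * x) - (1 + (n%:R + 1) * x) = n%:R * x ^+ 2 by ring.
by rewrite mulr_ge0 ?sqr_ge0.
Qed.

Lemma expr_1B_le (R : realType) (x : R) n : 0 < x -> x <= 1 -> (0 < n)%N ->
  (1 - x) ^+ n <= (n%:R * x)^-1.
Proof.
move=> x0 x1 n0; have nx : 0 < n%:R * x by rewrite mulr_gt0 // ltr0n.
rewrite -[X in _ <= X]mul1r ler_pdivlMr //.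
apply: (@le_trans _ _ ((1 - x) ^+ n * (1 + x) ^+ n)).
  rewrite ler_wpM2l ?exprn_ge0 ?subr_ge0 //.
  by apply: le_trans (bernoulli_le n _); rewrite ?mulr_natl; lra.
by rewrite -exprMn exprn_ile1 //; nra.
Qed.

Section Stages.
Context (R : realType) (d : nat) (p : 'M[R]_d.+1) (nu : 'I_d -> R).
Hypothesis p_transition : transition_matrix p.
Hypothesis p_irreducible : irreducible_matrix p.
Hypothesis nu_traffic : traffic_equation p nu.
Local Notation letter := ('I_d.+1 * 'I_d.+1)%type.
Implicit Types (s u v : seq letter).
Variable w : seq letter.

Section Count.
Variable r : nat.
Local Notation l := (r.+1 * size w)%N.

Definition successes s B := (\sum_(b < B) success w r s b)%N.
Definition calms s B := (\sum_(b < B) calm w r s b)%N.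

Lemma calm_cat s s' b : (b * l <= size s)%N -> calm w r (s ++ s') b = calm w r s b.
Proof. by move=> bs; rewrite /calm takel_cat. Qed.

Lemma success_cat s s' b : (b.+1 * l <= size s)%N ->
  success w r (s ++ s') b = success w r s b.
Proof.
move=> bs; have bs' : (b * l <= size s)%N by apply: leq_trans bs; rewrite leq_mul2r leqnSn orbT.
by rewrite /success calm_cat // !take_drop -mulSn takel_cat.
Qed.

Lemma successes_take s B m : (B * l <= m)%N -> successes (take m s) B = successes s B.
Proof.
move=> Bm; apply: eq_bigr => b _; case: (leqP (size s) m) => [sm|ms].
  by rewrite take_oversize.
rewrite -[in RHS](cat_take_drop m s) success_cat // size_take ms.
by apply: leq_trans Bm; rewrite leq_mul2r ltn_ord orbT.
Qed.

Variable theta : R.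
Hypothesis theta_gt0 : 0 < theta.
Hypothesis theta_le1 : theta <= 1.
Definition word_prob := \prod_(a <- wpow w r.+1) weight p a.
(** The mean of theta^[success] over a calm block. *)
Definition calm_factor := 1 - word_prob * (1 - theta).
Hypothesis calm_factor_gt0 : 0 < calm_factor.

(** Each calm block multiplies theta^successes by a factor of mean
    [calm_factor], independently of the past; dividing this out gives a
    martingale. *)
Lemma success_martingale B :
  expect p (B * l) (fun s => theta ^+ successes s B * calm_factor ^- calms s B) = 1.
Proof.
elim: B => [|B IH]; first by rewrite /= /successes /calms !big_ord0 !expr0 invr1 mulr1.
rewrite mulSnr expect_cat -[RHS]IH; apply: eq_expect => u su.
have old v : successes (u ++ v) B = successes u B /\ calms (u ++ v) B = calms u B.
  split; apply: eq_bigr => b _; rewrite ?success_cat ?calm_cat // su leq_mul2r.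
    by rewrite ltn_ord orbT.
  by rewrite ltnW ?orbT.
have calmB v : calm w r (u ++ v) B = calm w r u B by rewrite calm_cat ?su.
have [calm_u|calm_u] := boolP (calm w r u B); last first.
  rewrite -[RHS](expect_cst p_transition l); apply: eq_expect => v _.
  rewrite /successes /calms !big_ord_recr /= -/(successes _ _) -/(calms _ _).
  by rewrite (old v).1 (old v).2 /success calmB (negbTE calm_u) !addn0.
pose c := theta ^+ successes u B * calm_factor ^- calms u B.
transitivity (expect p l (fun v => c * calm_factor^-1 *
    (1 + (theta - 1) * (v == wpow w r.+1)%:R))).
  apply: eq_expect => v sv.
  rewrite /successes /calms !big_ord_recr /= -/(successes _ _) -/(calms _ _).
  rewrite (old v).1 (old v).2 /success calmB calm_u /= -su drop_size_cat // take_oversize ?sv //.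
  rewrite !exprD invfM expr1 /c.
  move: (theta ^+ successes u B) (calm_factor ^+ calms u B)^-1 calm_factor^-1 => x y z.
  by case: (v == _); rewrite ?expr0 ?expr1 ?mulr1n ?mulr0n; ring.
rewrite expectZ expectD expect_cst // expectZ.
have -> : l = size (wpow w r.+1) by rewrite size_wpow.
rewrite expect_word // -/word_prob.
have -> : 1 + (theta - 1) * word_prob = calm_factor by rewrite /calm_factor; ring.
by rewrite divfK // gt_eqF.
Qed.

Variable beta : R.
Hypothesis beta_gt1 : 1 < beta.
Hypothesis beta_rho : forall j, utilization p nu j * beta < 1.
Local Notation C := (tail_const p nu beta).

(** Markov's inequality for the number of blocks that are not calm, each of
    which has small probability by the uniform tail bound. *)
Lemma few_calms B : (0 < B)%N ->
  expect p (2 * B * l) (fun s => (calms s (2 * B) < B)%N%:R) <= 2 * (C * beta ^- r.+1).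
Proof.
move=> B0.
pose F b s : R := ((r.+1)%:Z <= population (run 0 (take (b * l) s)))%R%:R.
have markov s : (calms s (2 * B) < B)%N%:R <= B%:R^-1 * \sum_(b < 2 * B) F b s.
  have -> : \sum_(b < 2 * B) F b s = (2 * B)%:R - (calms s (2 * B))%:R.
    have -> : (2 * B)%:R = \sum_(b < 2 * B) 1 :> R by rewrite sumr_const card_ord.
    rewrite /calms natr_sum -sumrB.
    apply: eq_bigr => b _; rewrite /F /calm.
    set x := population _; have -> : (r.+1%:Z <= x) = ~~ (x <= r%:Z) by lia.
    by case: (x <= _); rewrite /= ?subrr ?subr0.
  rewrite ler_pdivlMl ?ltr0n //; case: ltnP => h.
    by rewrite mulr1 lerBrDl -natrD ler_nat; lia.
  rewrite mulr0 subr_ge0 ler_nat /calms.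
  apply: leq_trans (leq_sum _ (fun b _ => leq_b1 _)) _.
  by rewrite sum1_card card_ord.
apply: le_trans (expect_le p_transition (fun s _ => markov s)) _.
rewrite expectZ expect_sum // ler_pdivrMl ?ltr0n //.
apply: (@le_trans _ _ (\sum_(b < 2 * B) C * beta ^- r.+1)).
  apply: ler_sum => b _; rewrite /F (expect_take p_transition (fun s => (r.+1%:Z <= population (run 0 s))%R%:R)).
    exact: population_tail.
  by rewrite leq_mul2r ltnW ?orbT.
rewrite sumr_const card_ord -[X in X <= _]mulr_natl natrM -mulrA mulrCA.
by rewrite le_eqVlt eqxx.
Qed.

(** Either fewer than half of the blocks are calm, or the exponential martingale
    is at least theta^M / calm_factor^B. *)
Lemma few_successes B M : (0 < B)%N ->
  expect p (2 * B * l) (fun s => (successes s (2 * B) < M)%N%:R) <=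
  2 * (C * beta ^- r.+1) + theta ^- M * calm_factor ^+ B.
Proof.
move=> B0.
have c1 : calm_factor <= 1.
  rewrite /calm_factor gerBl mulr_ge0 ?subr_ge0 //.
  by apply: prodr_ge0 => a _; exact: weight_ge0.
apply: (@le_trans _ _ (expect p (2 * B * l) (fun s => (calms s (2 * B) < B)%N%:R +
   (theta ^- M * calm_factor ^+ B) *
   (theta ^+ successes s (2 * B) * calm_factor ^- calms s (2 * B))))).
  apply: expect_le => // s _.
  have pos : 0 <= theta ^- M * calm_factor ^+ B *
     (theta ^+ successes s (2 * B) * calm_factor ^- calms s (2 * B)).
    by rewrite !mulr_ge0 ?invr_ge0 ?exprn_ge0 // ltW.
  case: (ltnP (successes _ _)) => sM; last by rewrite addr_ge0.
  case: (ltnP (calms _ _)) => cB; first by rewrite lerDl.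
  rewrite add0r mulrACA -[X in X <= _]mulr1 ler_pM //.
    by rewrite mulrC ler_pdivlMr ?exprn_gt0 // mul1r ler_wiXn2l ?(ltW theta_gt0) // ltnW.
  by rewrite ler_pdivlMr ?exprn_gt0 // mul1r ler_wiXn2l ?(ltW calm_factor_gt0).
by rewrite expectD expectZ success_martingale mulr1 lerD2r few_calms.
Qed.

End Count.

Lemma tail_rate : (forall j, utilization p nu j < 1) ->
  exists2 beta : R, 1 < beta & forall j, utilization p nu j * beta < 1.
Proof.
move=> stable.
pose m := \big[Num.max/0]_j utilization p nu j.
have m0 : 0 <= m by exact: bigmax_ge_id.
have m1 : m < 1 by apply: bigmax_lt.
exists (2 / (1 + m)); first by rewrite ltr_pdivlMr; lra.
move=> j; have jm : utilization p nu j <= m by exact: le_bigmax.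
rewrite mulrA ltr_pdivrMr; lra.
Qed.

Lemma word_probE r : word_prob r = (\prod_(a <- w) weight p a) ^+ r.+1.
Proof.
rewrite /word_prob /wpow; elim: r.+1 => [|n IH]; first by rewrite big_nil expr0.
by rewrite exprS -IH big_cat.
Qed.

Definition horizon A r := (2 * A ^ r * (r.+1 * size w))%N.

(** The second clause looks ahead to the end of stage r+1, because between the
    two horizons only the successes of stage r can be relied on. *)
Definition bad_stage A H c r s :=
  (successes r s (2 * A ^ r) < H * r)%N ||
  [exists k : 'I_(horizon A r.+1).+1,
     (H * r - c)%N%:Z <= population (run 0 (take k s))].

Hypothesis stable : forall j, utilization p nu j < 1.
Hypothesis w_gt0 : all (fun a => 0 < weight p a) w.
Hypothesis w_size : (0 < size w)%N.

Lemma horizonS A r : (0 < A)%N ->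
  ((horizon A r.+1).+1 <= 6 * A * size w * (2 * A) ^ r)%N.
Proof.
move=> A0; rewrite /horizon.
have r2 : (r.+2 <= 2 * 2 ^ r)%N.
  by rewrite -expnS; exact: ltn_expl.
have A1 : (0 < A ^ r.+1)%N by rewrite expn_gt0 A0.
apply: (@leq_trans (3 * (A ^ r.+1 * (r.+2 * size w)))%N).
  by rewrite -mulnA; nia.
rewrite expnMn expnS.
have -> : (6 * A * size w * (2 ^ r * A ^ r) =
   3 * (A * A ^ r * (2 * 2 ^ r * size w)))%N by ring.
by rewrite !leq_mul.
Qed.

Lemma weight_le1 a : weight p a <= 1.
Proof.
rewrite -(weight_sum p_transition) (bigD1 a) //= lerDl.
by apply: sumr_ge0 => b _; exact: weight_ge0.
Qed.

(** The constants are chosen in the order beta, A, H, theta.  A eta >= 4 makes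
    the expected number of successes in stage r grow like 4^r; beta^H >= 4 A beats
    the length of the stage in a union bound over its times; theta^H >= 1/2 keeps
    the factor theta^(- H r) below 2^r. *)
Lemma bad_stage_rare c : exists A H (G g : R),
  [/\ (0 < A)%N, 0 <= g, g < 1 &
   forall r, expect p (horizon A r.+1) (fun s => (bad_stage A H c r s)%:R) <= G * g ^+ r].
Proof.
have [beta beta1 beta_rho] := tail_rate stable.
have beta0 : 0 < beta by apply: lt_trans beta1.
set C := tail_const p nu beta.
have C0 : 0 <= C by exact: tail_const_ge0.
pose eta := \prod_(a <- w) weight p a.
have eta0 : 0 < eta.
  rewrite /eta; elim: w w_gt0 => [|a u IH]; first by rewrite big_nil.
  by move=> /= /andP[a0 u0]; rewrite big_cons mulr_gt0 // IH.
have eta1 : eta <= 1.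
  rewrite /eta; elim: w => [|a u IH]; first by rewrite big_nil.
  rewrite big_cons mulr_ile1 ?weight_le1 ?weight_ge0 //.
  by apply: prodr_ge0 => b _; exact: weight_ge0.
have [A A_eta] : exists A : nat, 4 <= A%:R * eta.
  exists (Num.bound (4 / eta)).
  by rewrite -ler_pdivrMr // ltW // archi_boundP // divr_ge0 // ltW.
have A0 : (0 < A)%N.
  by rewrite -(ltr0n R) -(pmulr_lgt0 _ eta0); apply: lt_le_trans A_eta.
have [H H_gt0 betaH] : exists2 H, (0 < H)%N & 4 * A%:R <= beta ^+ H.
  exists (Num.bound (4 * A%:R / (beta - 1))).+1 => //.
  rewrite [X in X ^+ _](_ : beta = 1 + (beta - 1)); last by ring.
  apply: le_trans (bernoulli_le _ _); last by lra.
  rewrite -[(beta - 1) *+ _]mulr_natl -lerBlDl; apply: (@le_trans _ _ (4 * A%:R)); first by lra.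
  rewrite -ler_pdivrMr ?subr_gt0 //.
  apply: (@le_trans _ _ (Num.bound (4 * A%:R / (beta - 1)))%:R); last by rewrite ler_nat.
  by rewrite ltW // archi_boundP // divr_ge0 ?mulr_ge0 // subr_ge0 ltW.
have H0 : 0 < H%:R :> R by rewrite ltr0n.
have H1 : 1 <= H%:R :> R by rewrite ler1n.
have [theta thetaE] : exists theta : R, theta = 1 - (2 * H%:R)^-1 by exists (1 - (2 * H%:R)^-1).
have H2 : 0 < 2 * H%:R :> R by rewrite mulr_gt0.
have half_inv : (2 * H%:R)^-1 <= 2^-1 :> R by rewrite lef_pV2 ?posrE // ler_peMr.
have inv0 : 0 < (2 * H%:R)^-1 :> R by rewrite invr_gt0.
have theta0 : 0 < theta by rewrite thetaE; lra.
have theta1 : theta <= 1 by rewrite thetaE; lra.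
have thetaH : 2^-1 <= theta ^+ H.
  rewrite thetaE; apply: le_trans (bernoulli_le H _); last by lra.
  rewrite -[_ *+ H]mulr_natl mulrN invfM mulrCA divff ?gt_eqF //; lra.
exists A, H, (2 * C + 2 * H%:R / eta + (6 * A * size w)%:R * (C * beta ^+ c)),
  (Num.max beta^-1 2^-1).
have betaV : beta^-1 < 1 by rewrite invf_lt1.
split=> //; first by rewrite le_max invr_ge0 (ltW beta0).
  by rewrite gt_max betaV; lra.
move=> r; set g := Num.max _ _.
have half0 : 0 <= 2^-1 :> R by rewrite invr_ge0.
have betaV0 : 0 <= beta^-1 by rewrite invr_ge0 ltW.
have g0 : 0 <= g by rewrite le_max betaV0.
have g_beta : beta ^- r <= g ^+ r.
  by rewrite -exprVn lerXn2r ?nnegrE // le_max lexx.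
have g_half : 2 ^- r <= g ^+ r.
  by rewrite -exprVn lerXn2r ?nnegrE // le_max lexx orbT.
(* The first two terms of G bound the first way of failing, the last term the second. *)
pose few s := (successes r s (2 * A ^ r) < H * r)%N.
pose high k s := (H * r - c)%N%:Z <= population (run 0 (take k s)).
apply: (@le_trans _ _ (expect p (horizon A r.+1) (fun s =>
   (few (take (horizon A r) s))%:R +
   \sum_(k < (horizon A r.+1).+1) (high k s)%:R))).
  apply: expect_le => // s _; rewrite /bad_stage /few successes_take // -/(few s).
  case: (boolP (few s)) => /= _; first by rewrite lerDl sumr_ge0.
  case: (boolP [exists k, _]) => [/existsP[k hk]|_]; rewrite add0r; last by rewrite sumr_ge0.
  by rewrite (bigD1 k) //= /high hk lerDl sumr_ge0.
have hor_le : (horizon A r <= horizon A r.+1)%N.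
  rewrite /horizon leq_mul // ?leq_mul2l ?leq_pexp2l ?leqnSn //.
  by rewrite leq_mul2r leqnSn orbT.
rewrite expectD (expect_take p_transition (fun s => (few s)%:R)) // expect_sum //.
rewrite [X in _ <= X]mulrDl lerD //.
  have q0 : 0 < word_prob r by rewrite word_probE exprn_gt0.
  have q1 : word_prob r <= 1 by rewrite word_probE exprn_ile1 // ltW.
  have qt0 : 0 < word_prob r * (1 - theta) by rewrite mulr_gt0 // thetaE; lra.
  have qt1 : word_prob r * (1 - theta) <= 2^-1.
    rewrite -[X in _ <= X]mul1r ler_pM // ?(ltW q0) // thetaE; lra.
  have Ar0 : (0 < A ^ r)%N by rewrite expn_gt0 A0.
  have cf0 : 0 < calm_factor r theta by rewrite /calm_factor; lra.
  apply: le_trans (few_successes theta0 theta1 cf0 beta1 beta_rho (H * r) Ar0) _.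
  rewrite [X in _ <= X]mulrDl lerD //.
    rewrite -mulrA ler_wpM2l // ler_wpM2l //; apply: le_trans g_beta.
    by rewrite lef_pV2 ?posrE ?exprn_gt0 // ler_weXn2l // ltW.
  apply: (@le_trans _ _ (2 ^+ r * (4 ^+ r * (eta / (2 * H%:R)))^-1)).
    rewrite ler_pM ?invr_ge0 ?exprn_ge0 ?(ltW theta0) ?(ltW cf0) //.
      by rewrite exprM -[2]invrK exprVn lef_pV2 ?posrE ?exprn_gt0 ?lerXn2r ?nnegrE ?exprn_ge0 ?(ltW theta0).
    apply: le_trans (expr_1B_le qt0 _ Ar0) _; first by lra.
    have lower0 : 0 < 4 ^+ r * (eta / (2 * H%:R)).
      by rewrite mulr_gt0 ?exprn_gt0 ?divr_gt0 // mulr_gt0.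
    have upper0 : 0 < (A ^ r)%:R * (word_prob r * (1 - theta)).
      by rewrite mulr_gt0 ?ltr0n.
    rewrite lef_pV2 ?posrE //.
    rewrite word_probE -/eta thetaE exprS [(A ^ r)%:R]natrX.
    (* The factor A^r from the number of blocks meets the eta^r from the word probability. *)
    have -> : A%:R ^+ r * (eta * eta ^+ r * (1 - (1 - (2 * H%:R)^-1))) =
      (A%:R * eta) ^+ r * (eta / (2 * H%:R)) by rewrite exprMn; ring.
    have Aeta0 : 0 <= A%:R * eta by rewrite mulr_ge0 // ltW.
    rewrite ler_wpM2r //; last by rewrite lerXn2r ?nnegrE.
    by rewrite ltW // divr_gt0 // mulr_gt0.
  rewrite [_ ^-1]invfM mulrA invf_div.
  have -> : 2 ^+ r / 4 ^+ r = 2 ^- r :> R.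
    have -> : 4 = 2 * 2 :> R by ring.
    by rewrite exprMn invfM mulrA divff ?mul1r // expf_neq0.
  by rewrite mulrC ler_wpM2l // divr_ge0 ?mulr_ge0 // ltW.
apply: (@le_trans _ _ (\sum_(k < (horizon A r.+1).+1) C * beta ^- (H * r - c))).
  apply: ler_sum => k _; rewrite (expect_take p_transition (fun s => ((H * r - c)%N%:Z <= population (run 0 s))%R%:R)).
    exact: population_tail.
  by rewrite -ltnS.
rewrite sumr_const card_ord -[_ *+ _]mulr_natl.
apply: (@le_trans _ _ ((6 * A * size w * (2 * A) ^ r)%:R * (C * (beta ^+ c * (4 * A%:R) ^- r)))).
  rewrite ler_pM ?ler_nat ?horizonS // ?mulr_ge0 ?invr_ge0 ?exprn_ge0 ?(ltW beta0) //.
  rewrite ler_wpM2l //; apply: (@le_trans _ _ (beta ^+ c * beta ^- (H * r))).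
    rewrite ler_pdivlMr ?exprn_gt0 // mulrC ler_pdivrMr ?exprn_gt0 // -exprD.
    by rewrite ler_weXn2l ?(ltW beta1) // -leq_subLR.
  rewrite ler_wpM2l ?exprn_ge0 ?(ltW beta0) // lef_pV2 ?posrE ?exprn_gt0 ?mulr_gt0 ?ltr0n //.
  by rewrite exprM lerXn2r ?nnegrE ?mulr_ge0 ?exprn_ge0 ?(ltW beta0).
have -> : (6 * A * size w * (2 * A) ^ r)%:R * (C * (beta ^+ c * (4 * A%:R) ^- r)) =
  (6 * A * size w)%:R * (C * beta ^+ c) * 2 ^- r.
  rewrite [LHS]mulrC natrM natrX [(2 * A)%:R]natrM [(2 * A%:R) ^+ r]exprMn.
  have -> : (4 * A%:R) ^+ r = 2 ^+ r * 2 ^+ r * A%:R ^+ r :> R.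
    by rewrite -!exprMn; congr (_ ^+ _); ring.
  have A2 : A%:R ^+ r != 0 :> R by rewrite expf_neq0 // pnatr_eq0 -lt0n.
  have two : 2 ^+ r != 0 :> R by rewrite expf_neq0.
  move: (2 ^+ r) (A%:R ^+ r) two A2 (6 * A * size w)%:R (beta ^+ c) => x y x0 y0 z t.
  by field; rewrite x0 y0.
by rewrite ler_wpM2l // mulr_ge0 ?mulr_ge0 ?exprn_ge0 // ltW.
Qed.

End Stages.

(** * The law of the increments *)

Section Law.
Context (R : realType) (d : nat) (p : 'M[R]_d.+1).
Context (disp : measure_display) (T : measurableType disp) (P : probability T R).
Variable I : nat -> T -> 'rV[int]_d.
Hypothesis p_transition : transition_matrix p.
Hypothesis I_iid : iid_increments p P I.
Local Notation letter := ('I_d.+1 * 'I_d.+1)%type.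
Implicit Types (s u v : seq letter) (a : letter).

Definition nonloop a := a.1 != a.2.

Definition prefix_of w k := mkseq (fun t => I t w) k.

Lemma measurable_prefix k (B : set (seq 'rV[int]_d)) :
  measurable [set w | B (prefix_of w k)].
Proof.
case: I_iid => I_meas _ _.
elim: k B => [|k IH] B.
  have [B0|B0] := pselect (B [::]).
    by rewrite (_ : [set _ | _] = setT) //; apply/seteqP; split.
  by rewrite (_ : [set _ | _] = set0) //; apply/seteqP; split.
rewrite (_ : [set w | _] = \bigcup_(v : 'rV[int]_d)
    ((I k @^-1` [set v]) `&` [set w | B (rcons (prefix_of w k) v)])).
  apply: countable_bigcupT_measurable => [|v]; first exact: countableP.
  by apply: measurableI; [exact: I_meas|have := IH [set s | B (rcons s v)]; apply].
apply/seteqP; split => w /=; rewrite /prefix_of.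
  by rewrite mkseqS => Bw; exists (I k w).
by move=> [v _ [/= <-]]; rewrite mkseqS.
Qed.

Lemma probability_prefix s : all nonloop s ->
  P [set w | prefix_of w (size s) = map (@hop d) s] =
  (\prod_(a <- s) weight p a)%:E.
Proof.
case: I_iid => _ I_indep I_law s_proper.
pose a0 : letter := (ord0, ord0).
pose K : {fset nat} := [fset t in iota 0 (size s)]%fset.
have -> : [set w | prefix_of w (size s) = map (@hop d) s] =
    \bigcap_(t in [set` K]) (I t @^-1` [set hop (nth a0 s t)]).
  apply/seteqP; split => w /=.
    move=> ws t; rewrite /= !inE mem_iota add0n => /= ts.
    by rewrite -(nth_map a0 0) // -ws nth_mkseq.
  move=> ws; apply: (@eq_from_nth _ 0); rewrite size_mkseq ?size_map // => t ts.
  rewrite nth_mkseq // (nth_map a0) //; apply: (ws t).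
  by rewrite /= !inE mem_iota.
rewrite I_indep.
have -> : (\prod_(k <- K) P (I k @^-1` [set hop (nth a0 s k)]) =
   \prod_(k <- iota 0 (size s)) P (I k @^-1` [set hop (nth a0 s k)]))%E.
  apply: perm_big; apply: uniq_perm; rewrite ?iota_uniq ?fset_uniq // => t.
  by rewrite !inE.
rewrite -[in RHS](mkseq_nth a0 s) /mkseq big_map.
have: {in iota 0 (size s), forall t, nonloop (nth a0 s t)}.
  by move=> t; rewrite mem_iota => ts; apply: (allP s_proper); rewrite mem_nth.
elim: (iota _ _) => [|t r IH] r_proper; first by rewrite !big_nil.
rewrite !big_cons EFinM IH => [|t' t'r]; last by apply: r_proper; rewrite inE t'r orbT.
by rewrite I_law //; apply: r_proper; rewrite mem_head.
Qed.

Lemma measure_bigsetU_le (J : Type) (r : seq J) (F : J -> set T) :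
  (forall j, measurable (F j)) ->
  (P (\big[setU/set0]_(j <- r) F j) <= \sum_(j <- r) P (F j))%E.
Proof.
move=> mF; elim: r => [|j r IH]; first by rewrite !big_nil measure0.
rewrite !big_cons; apply: le_trans (measureU2 _ _ _) _ => //.
  by apply: bigsetU_measurable => k _.
by rewrite leeD2l.
Qed.

(** Quantifying over words makes this an event about the increments alone,
    without choosing letters measurably. *)
Definition word_event (B : pred (seq letter)) u k : set T :=
  [set w | exists s, [/\ size s = k, all nonloop s, B (u ++ s) &
     prefix_of w (size (u ++ s)) = map (@hop d) (u ++ s)]].

Lemma measurable_word_event B u k : measurable (word_event B u k).
Proof.
rewrite (_ : word_event B u k = [set w | [set v | exists s, [/\ size s = k, all nonloop s,
   B (u ++ s) & v = map (@hop d) (u ++ s)]] (prefix_of w (size u + k))]).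
  exact: measurable_prefix.
apply/seteqP; split => w /= [s [sk sp Bs ws]]; exists s; split=> //.
  by rewrite -sk -size_cat.
by rewrite size_cat sk.
Qed.

(** Subadditivity over the first letter that is not yet prescribed reduces to
    the case in which all the letters are prescribed, where independence
    applies.  An upper bound suffices because only bad events are estimated. *)
Lemma word_event_le B u k : all nonloop u ->
  (P (word_event B u k) <=
   (\prod_(a <- u) weight p a * expect p k (fun s => (B (u ++ s))%:R))%:E)%E.
Proof.
elim: k u => [|k IH] u up /=.
  rewrite cats0; have [Bu|Bu] := boolP (B u); last first.
    rewrite (_ : word_event _ _ _ = set0) ?measure0 ?lee_fin ?mulr0 //.
    by apply/seteqP; split=> // w [s [/size0nil -> _]]; rewrite cats0 (negbTE Bu).
  rewrite mulr1 -probability_prefix //; apply: le_measure; rewrite ?inE.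
  - exact: measurable_word_event.
  - exact: (measurable_prefix _ [set v | v = map (@hop d) u]).
  - by move=> w [s [/size0nil -> _ _]]; rewrite cats0.
(* Loops have weight 0 in [expect] but stand for no increment, hence the empty set. *)
pose F a := if nonloop a then word_event B (rcons u a) k else set0.
have mF a : measurable (F a).
  by rewrite /F; case: ifP => _; [exact: measurable_word_event|exact: measurable0].
apply: (@le_trans _ _ (P (\big[setU/set0]_(a : letter) F a))).
  apply: le_measure; rewrite ?inE.
  - exact: measurable_word_event.
  - by apply: bigsetU_measurable => a _.
  - move=> w [s [+ + + +]]; case: s => [|a s] //= [sk] /andP[ap sp] Bs ws.
    rewrite -bigcup_seq; exists a => /=; first by rewrite mem_index_enum.
    by rewrite /F ap; exists s; rewrite cat_rcons.
apply: le_trans (measure_bigsetU_le _ mF) _.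
rewrite mulr_sumr -sumEFin; apply: lee_sum => a _; rewrite /F.
have pos : 0 <= \prod_(b <- u) weight p b *
    (weight p a * expect p k (fun s => (B (u ++ a :: s))%:R)).
  rewrite mulr_ge0 ?mulr_ge0 ?weight_ge0 //.
    by apply: prodr_ge0 => b _; exact: weight_ge0.
  by rewrite -(expect_cst p_transition k 0); apply: expect_le.
case: ifP => ap; last by rewrite measure0 lee_fin.
apply: le_trans (IH _ _) _; first by rewrite all_rcons ap.
rewrite lee_fin -cats1 big_cat big_seq1 -mulrA.
rewrite le_eqVlt; apply/orP; left; apply/eqP; congr (_ * (_ * _)).
by apply: eq_expect => s _; rewrite -catA.
Qed.

(** The increment e_l - e_j reveals l as the position of its entry 1, and j by
    antisymmetry; l = 0 is the case without such an entry. *)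
Lemma hop_coord_pos a (i : 'I_d) : nonloop a -> (hop a ord0 i == 1) = (a.2 == node i).
Proof.
case: a => j l /= jl; rewrite /hop coordD coordN /=.
have [->|[k lk]] := nodeP l.
  rewrite unit_vec0 [_ == node i]eq_sym (negbTE (node_neq0 i)).
  have -> : (0 : 'rV[int]_d) ord0 i = 0 by rewrite mxE.
  by have := unit_vec_ge0 j i; lia.
rewrite lk unit_vec_nodeE (inj_eq (@node_inj d)) eq_sym.
have [ik|ik] := eqVneq k i; last by have := unit_vec_ge0 j i; rewrite natz; lia.
suff -> : unit_vec j ord0 i = 0 :> int by rewrite natz.
have [->|[m jm]] := nodeP j; first by rewrite unit_vec0 mxE.
rewrite jm unit_vec_nodeE; case: eqP => // im.
by move: jl; rewrite /nonloop /= jm lk -im ik eqxx.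
Qed.

Lemma hop_swap j (l : 'I_d.+1) : hop (j, l) = - hop (l, j) :> 'rV[int]_d.
Proof. by rewrite /hop opprB. Qed.

Lemma hop_inj a b : nonloop a -> nonloop b -> hop a = hop b -> a = b.
Proof.
have target j l j' l' : nonloop (j, l) -> nonloop (j', l') ->
    hop (j, l) = hop (j', l') -> l = l'.
  move=> ap bp ab.
  have same i : (l == node i) = (l' == node i).
    by rewrite -(hop_coord_pos i ap) -(hop_coord_pos i bp) ab.
  have [l0|[i li]] := nodeP l; last by have := same i; rewrite li eqxx => /esym/eqP.
  have [l0'|[i li]] := nodeP l'; first by rewrite l0 l0'.
  by have := same i; rewrite li eqxx => /eqP.
case: a b => j l [j' l'] ap bp ab; congr pair; last exact: target ap bp ab.
apply: (target l j l' j'); rewrite /nonloop /= 1?eq_sym //.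
by rewrite hop_swap ab -hop_swap.
Qed.

Definition lawless : set T := \bigcup_t [set w | ~ exists2 a, nonloop a & I t w = hop a].

Lemma measurable_lawless_at t :
  measurable [set w | ~ exists2 a, nonloop a & I t w = hop a].
Proof.
case: I_iid => I_meas _ _.
exact: (I_meas t [set v | ~ exists2 a, nonloop a & v = hop a]).
Qed.

Lemma measurable_lawless : measurable lawless.
Proof. by apply: bigcupT_measurable => t; exact: measurable_lawless_at. Qed.

(** The values e_l - e_j are pairwise distinct and their probabilities already
    add up to 1. *)
Lemma lawless0 : P lawless = 0%E.
Proof.
case: I_iid => I_meas _ I_law.
apply/eqP; rewrite eq_le measure_ge0 andbT.
apply: le_trans (measure_sigma_subadditive _ measurable_lawless_at measurable_lawless (@subset_refl _ _)) _.
rewrite eseries0 // => t _ _.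
change (P (~` [set w | exists2 a, nonloop a & I t w = hop a]) = 0%E).
rewrite probability_setC; last first.
  exact: (I_meas t [set v | exists2 a, nonloop a & v = hop a]).
suff -> : P [set w | exists2 a, nonloop a & I t w = hop a] = 1%E by rewrite subee.
pose F a := I t @^-1` [set (hop a : 'rV[int]_d)].
have -> : [set w | exists2 a, nonloop a & I t w = hop a] =
    \big[setU/set0]_(a <- [seq a <- index_enum _ | nonloop a]) F a.
  rewrite -bigcup_seq; apply/seteqP; split => w /= [a ap wa]; exists a => //=.
    by rewrite /= mem_filter ap mem_index_enum.
  by move: ap; rewrite /= mem_filter => /andP[].
have additive (r : seq letter) : uniq r -> all nonloop r ->
    P (\big[setU/set0]_(a <- r) F a) = (\sum_(a <- r) weight p a)%:E.
  elim: r => [|a r IH] /=; first by rewrite !big_nil measure0.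
  move=> /andP[ar ur] /andP[ap rp]; rewrite !big_cons.
  have disj : F a `&` \big[setU/set0]_(b <- r) F b = set0.
    rewrite -bigcup_seq; apply/seteqP; split => // w [/= wa [b /= br wb]].
    have ab : a = b by apply: hop_inj => //; [exact: (allP rp)|rewrite -wa -wb].
    by move: ar; rewrite ab br.
  have mF b : measurable (F b) by exact: I_meas.
  have mU : measurable (\big[setU/set0]_(b <- r) F b).
    by apply: bigsetU_measurable => b _.
  transitivity (P (F a) + P (\big[setU/set0]_(b <- r) F b))%E; first exact: measureU.
  rewrite IH // EFinD; congr (_ + _)%E.
  by rewrite /F [a]surjective_pairing; exact: I_law.
rewrite additive ?filter_uniq ?index_enum_uniq ?filter_all //.
rewrite big_filter -(weight_sum p_transition) big_mkcond /=; congr (_%:E).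
apply: eq_bigr => a _; case: ifPn => //; rewrite negbK => /eqP e.
by rewrite /weight e transition_diag.
Qed.

End Law.

(** * Convergence of probabilities and first times *)

(** A form of dominated convergence for events: the symmetric difference of
    A_ n and A is eventually contained in each U m. *)
Lemma cvg_measure_agree (R : realType) (disp : measure_display)
    (T : measurableType disp) (P : probability T R)
    (A_ U : nat -> set T) (A : set T) :
  (forall n, measurable (A_ n)) -> measurable A -> (forall m, measurable (U m)) ->
  P (U m) @[m --> \oo] --> 0%E ->
  (forall m, \forall n \near \oo, forall w, ~ U m w -> (A_ n w <-> A w)) ->
  P (A_ n) @[n --> \oo] --> P A.
Proof.
move=> mA_ mA mU U0 agree.
have sub B C m : measurable B -> measurable C -> (forall w, ~ U m w -> B w -> C w) ->
    fine (P B) <= fine (P C) + fine (P (U m)).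
  move=> mB mC BC; rewrite -fineD ?fin_num_measure // fine_le ?fin_numD ?fin_num_measure //.
  apply: le_trans (measureU2 _ mC (mU m)); apply: le_measure; rewrite ?inE //.
    exact: measurableU.
  by move=> w Bw; have [Uw|Uw] := pselect (U m w); [right|left; exact: BC Bw].
rewrite -[P A]fineK ?fin_num_measure //.
apply/fine_cvgP; split; first by apply: nearW => n; exact: fin_num_measure.
apply/cvgrPdist_lt => e e0.
have /fine_cvgP[_ /cvgrPdist_lt /(_ e e0) [m _ Um]] := U0.
have {Um} := Um m (leqnn m); rewrite /= sub0r normrN => Um.
have P_small : fine (P (U m)) < e by apply: le_lt_trans Um; exact: ler_norm.
apply: filterS (agree m) => n An /=.
have le1 := sub _ _ m (mA_ n) mA (fun w Uw => (An w Uw).1).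
have le2 := sub _ _ m mA (mA_ n) (fun w Uw => (An w Uw).2).
by rewrite ltr_norml; apply/andP; split; lra.
Qed.

Section FirstTimes.
Context (R : realType) (d : nat).
Implicit Types z : nat -> 'rV[int]_d.

Lemma level_before_originP n z :
  (tau_level R n z < tau_origin R z)%E <->
  exists k, population (z k) = n%:Z /\ forall t, z t = 0 -> (k < t)%N.
Proof.
split.
  move=> /ereal_inf_lt [_ [k /= kn <-]] lt0; exists k; split=> // t zt.
  rewrite -(ltr_nat R) -lte_fin; apply: lt_le_trans lt0 _.
  by apply: ereal_inf_lbound; exists t.
move=> [k [kn k0]]; apply: (@le_lt_trans _ _ k%:R%:E).
  by apply: ereal_inf_lbound; exists k.
apply: (@lt_le_trans _ _ k.+1%:R%:E); first by rewrite lte_fin ltr_nat.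
apply: le_ereal_inf_tmp => _ [t /= zt <-]; rewrite lee_fin ler_nat.
exact: k0.
Qed.

Lemma diag_finiteP i z : (tau_diag R i z < +oo)%E <->
  exists k, z k ord0 i = \sum_(j < d | j != i) z k ord0 j.
Proof.
split=> [/ereal_inf_lt [_ [k /= ki _] _]|[k ki]]; first by exists k.
by apply: (@le_lt_trans _ _ k%:R%:E); [apply: ereal_inf_lbound; exists k|exact: ltry].
Qed.

End FirstTimes.

(** * Reflection *)

Section Reflection.
Context (d : nat) (i : 'I_d).
Implicit Types (x y z v : 'rV[int]_d).

Lemma half_orthantP z :
  reflect (forall j, j != i -> 0 <= z ord0 j) (z \in half_orthant i).
Proof.
apply: (iffP forallP) => h j; first by move=> ji; have := h j; rewrite ji.
by apply/implyP; exact: h.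
Qed.

Lemma reflect_atE (n : int) z j :
  reflect_at i n z ord0 j = if j == i then n - z ord0 i else z ord0 j.
Proof. by rewrite mxE; case: eqP => [->|]. Qed.

Lemma flipE v j : flip i v ord0 j = if j == i then - v ord0 i else v ord0 j.
Proof. by rewrite mxE; case: eqP => [->|]. Qed.

Lemma reflect_orthant (n : int) y :
  y \in half_orthant i -> y ord0 i <= n -> reflect_at i n y \in @orthant d.
Proof.
move=> /half_orthantP y0 yn; apply/orthantP => j; rewrite reflect_atE.
by case: eqVneq => [_|/y0 //]; rewrite subr_ge0.
Qed.

Lemma reflect_at_flip (n : int) z v :
  reflect_at i n (z + flip i v) = reflect_at i n z + v.
Proof.
apply/rowP => j; rewrite [RHS]coordD !reflect_atE !coordD !flipE.
by case: eqVneq => [->|//]; rewrite eqxx opprD opprK addrA.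
Qed.

Lemma population_reflect n z : population (reflect_at i n%:Z z) = n%:Z <->
  z ord0 i = \sum_(j < d | j != i) z ord0 j.
Proof.
rewrite /population (bigD1 i) //= reflect_atE eqxx.
rewrite (eq_bigr (fun j => z ord0 j)) => [|j ji]; last first.
  by rewrite reflect_atE (negbTE ji).
move: (z ord0 i) (\sum_(j < d | _) _) => zi S.
by split=> h; lia.
Qed.

(** Before time n - y_i the reflected i-th coordinate is still positive, and then
    the orthant and the half-orthant impose the same constraints. *)
Lemma reflected_walk (n : nat) y (v : nat -> 'rV[int]_d) k :
  (forall t, -1 <= v t ord0 i) -> k%:Z <= n%:Z - y ord0 i ->
  constrained_walk (@orthant d) (reflect_at i n%:Z y) v k =
    reflect_at i n%:Z (constrained_walk (half_orthant i) y (fun t => flip i (v t)) k) /\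
  constrained_walk (half_orthant i) y (fun t => flip i (v t)) k ord0 i
    <= y ord0 i + k%:Z.
Proof.
move=> v1; elim: k => [|k IH] kn /=; first by rewrite addr0.
have /IH [-> zk] : k%:Z <= n%:Z - y ord0 i by lia.
set z := constrained_walk _ _ _ _ in zk *.
have vk := v1 k.
have -> : (reflect_at i n%:Z z + v k \in @orthant d) = (z + flip i (v k) \in half_orthant i).
  apply/orthantP/half_orthantP => h j.
    by move=> ji; have := h j; rewrite !coordD reflect_atE flipE (negbTE ji).
  have [->|ji] := eqVneq j i.
    by rewrite coordD reflect_atE eqxx; lia.
  by have := h j ji; rewrite !coordD reflect_atE flipE (negbTE ji).
case: ifP => _; last by split=> //; lia.
split; first by rewrite reflect_at_flip.
by rewrite coordD flipE eqxx; lia.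
Qed.

End Reflection.

Lemma hop_ge_m1 d (a : 'I_d.+1 * 'I_d.+1) (i : 'I_d) : -1 <= hop a ord0 i.
Proof.
rewrite /hop coordD coordN.
by have := unit_vec_ge0 a.2 i; have := unit_vec_le1 a.1 i; lia.
Qed.

Lemma take_mkseq (S : Type) (f : nat -> S) k n : (k <= n)%N ->
  take k (mkseq f n) = mkseq f k.
Proof. by move=> kn; rewrite /mkseq -map_take take_iota (minn_idPl kn). Qed.

(** * Good paths *)

Section GoodPaths.
Context (d : nat) (w : seq ('I_d.+1 * 'I_d.+1)) (A H c : nat).
Hypothesis w0 : run 0 w = 0.
Hypothesis w_drains :
  forall x, x \in @orthant d -> x != 0 -> population (run x w) < population x.
Hypothesis w_size : (0 < size w)%N.
Hypothesis A_gt0 : (0 < A)%N.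

Lemma horizon_bracket m k : (horizon w A m <= k)%N ->
  exists r, [/\ (m <= r)%N, (horizon w A r <= k)%N & (k < horizon w A r.+1)%N].
Proof.
move=> mk; have grows r : (r <= horizon w A r)%N.
  have Ar : (0 < A ^ r)%N by rewrite expn_gt0 A_gt0.
  by rewrite /horizon; nia.
have bounded r : (horizon w A r <= k)%N -> (r <= k)%N.
  exact: leq_trans (grows r).
have [r rk rmax] := ex_maxnP (ex_intro _ m mk) bounded.
exists r; split=> //; first exact: rmax.
by rewrite ltnNge; apply/negP => /rmax; rewrite ltnn.
Qed.

(** At a time k of stage r the population is at most that of the empty walk plus
    the initial one minus H r, which is less than n if stage r is good, unless the
    origin has been visited. *)
Lemma good_path (a : nat -> 'I_d.+1 * 'I_d.+1) m z n k :
  (forall r, (m <= r)%N -> ~~ bad_stage w A H c r (mkseq a (horizon w A r.+1))) ->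
  z \in @orthant d -> population z <= n%:Z + c%:Z ->
  (horizon w A m <= k)%N -> population (run z (mkseq a k)) = n%:Z ->
  exists2 t, (t <= k)%N & run z (mkseq a t) = 0.
Proof.
move=> good zO zn mk kn.
have [r [mr rk kr]] := horizon_bracket mk.
have := good r mr; rewrite /bad_stage negb_or -leqNgt => /andP[enough /existsPn low].
have k_hor : (k < (horizon w A r.+1).+1)%N by exact: ltnW.
have := low (Ordinal k_hor); rewrite /= -ltNge take_mkseq ?(ltnW kr) // => lowk.
have rr : (horizon w A r <= horizon w A r.+1)%N by apply: leq_trans rk (ltnW kr).
have := drained_after_blocks w0 w_drains r (mkseq a (horizon w A r.+1)) (2 * A ^ r) zO.
rewrite -/(horizon w A r) -/(successes w r _ _) take_mkseq // => -[[t tr zt]|drained].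
  exists t; first exact: leq_trans rk.
  by rewrite -zt take_mkseq // (leq_trans tr).
exfalso.
have b0 : below 0 z by move=> j; rewrite mxE; apply/orthantP.
have [b1 _] := run_below (mkseq a (horizon w A r)) (@orthant0 d) zO b0.
have split_k : mkseq a k = mkseq a (horizon w A r) ++ drop (horizon w A r) (mkseq a k).
  by rewrite -[LHS](cat_take_drop (horizon w A r)) take_mkseq.
have [_] := run_below (drop (horizon w A r) (mkseq a k))
  (run_orthant (mkseq a (horizon w A r)) (@orthant0 d))
  (run_orthant (mkseq a (horizon w A r)) zO) b1.
rewrite -!run_cat -split_k kn => decr.
have := population_ge0 (run_orthant (mkseq a k) (@orthant0 d)).
move: lowk decr drained enough zn; set S := population (run 0 (mkseq a k)).
move: (population _ - population _) (successes _ _ _ _) (population z) S (H * r)%N.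
by move=> D N Z S h; lia.
Qed.

End GoodPaths.

(** * The limit *)

Section Conclusion.
Context (R : realType) (d : nat) (p : 'M[R]_d.+1).
Context (disp : measure_display) (T : measurableType disp) (P : probability T R).
Variables (I : nat -> T -> 'rV[int]_d) (i : 'I_d) (y : 'rV[int]_d).
Hypothesis p_transition : transition_matrix p.
Hypothesis I_iid : iid_increments p P I.
Local Notation letter := ('I_d.+1 * 'I_d.+1)%type.

Lemma measurable_walk D x (f : 'rV[int]_d -> 'rV[int]_d) k (V : set 'rV[int]_d) :
  measurable [set w | V (constrained_walk D x (fun t => f (I t w)) k)].
Proof.
rewrite (_ : [set w | _] = [set w |
    [set s | V (foldl (cstep D) x (map f s))] (prefix_of I w k)]).
  exact: (measurable_prefix I_iid).
by apply/seteqP; split => w /=; rewrite constrained_walk_foldl /prefix_of /mkseq -map_comp.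
Qed.

Lemma measurable_level_before_origin n x :
  measurable [set w | (tau_level R n (X_walk I x w) < tau_origin R (X_walk I x w))%E].
Proof.
rewrite (_ : [set w | _] = \bigcup_k
  ([set w | [set z | population z = n%:Z] (X_walk I x w k)] `&`
   \bigcap_t [set w | [set z | z = 0 -> (k < t)%N] (X_walk I x w t)])).
  apply: bigcupT_measurable => k; apply: measurableI; first exact: measurable_walk id _ _.
  by apply: bigcapT_measurable => t; exact: measurable_walk id _ _.
apply/seteqP; split => w /=.
  by move=> /level_before_originP [k [kn k0]]; exists k => //; split=> // t _; exact: k0.
move=> [k _ [kn k0]]; apply/level_before_originP; exists k; split=> // t.
exact: k0.
Qed.

Lemma measurable_diag_finite x :
  measurable [set w | (tau_diag R i (Y_walk i I x w) < +oo)%E].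
Proof.
rewrite (_ : [set w | _] = \bigcup_k [set w |
   [set z : 'rV[int]_d | z ord0 i = \sum_(j < d | j != i) z ord0 j] (Y_walk i I x w k)]).
  by apply: bigcupT_measurable => k; exact: (measurable_walk _ _ (flip i)).
apply/seteqP; split => w /=.
  by move=> /diag_finiteP [k ki]; exists k.
by move=> [k _ ki]; apply/diag_finiteP; exists k.
Qed.

(** Borel-Cantelli, with the geometric series as majorant. *)
Lemma tail_null (B : nat -> set T) (G g : R) :
  (forall r, measurable (B r)) -> 0 <= g -> g < 1 ->
  (forall r, (P (B r) <= (G * g ^+ r)%:E)%E) ->
  P (lawless I `|` \bigcup_(r >= m) B r) @[m --> \oo] --> 0%E.
Proof.
move=> mB g0 g1 PB.
have mU m : measurable (\bigcup_(r >= m) B r) by apply: bigcup_measurable => r _.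
rewrite (_ : (fun m => _) = (fun m => P (\bigcup_(r >= m) B r))); last first.
  apply/funext => m; rewrite setUC measureU0 //; first exact: measurable_lawless I_iid.
  exact: (lawless0 p_transition I_iid).
rewrite -(_ : P (lim_sup_set B) = 0%E).
  apply: lim_sup_set_cvg => //; apply: (@le_lt_trans _ _ 1%E); last exact: ltry.
  exact: probability_le1.
apply: lim_sup_set_cvg0 => //.
pose G' := Num.max G 0.
(* A ratio in ]0, 1[ is required, and g may vanish. *)
pose h := Num.max g 2^-1.
have h0 : 0 < h by rewrite lt_max invr_gt0 ltr0n orbT.
have h1 : h < 1 by rewrite gt_max g1; lra.
apply: (@le_lt_trans _ _ (G' * (1 - h)^-1)%:E); last exact: ltry.
apply: lime_le; first by apply: is_cvg_nneseries => n _ _; exact: measure_ge0.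
apply: nearW => n.
apply: (@le_trans _ _ (series (geometric G' h) n)%:E); last first.
  rewrite lee_fin; apply: geometric_le_lim => //; first by rewrite le_max lexx orbT.
  by rewrite ger0_norm // ltW.
rewrite /series /= -sumEFin; apply: lee_sum => r _; apply: le_trans (PB r) _.
rewrite lee_fin /=; apply: (@le_trans _ _ (G' * g ^+ r)).
  by rewrite ler_wpM2r ?exprn_ge0 // le_max lexx.
by rewrite ler_wpM2l ?le_max ?lexx ?orbT // lerXn2r ?nnegrE ?le_max ?lexx ?(ltW h0) // g0.
Qed.

(** For the converse direction, a late visit of Y to the diagonal is turned into
    a late visit to level n' of the X-walk for a much larger n', which good paths
    forbid as well; so the diagonal is visited early, when both walks agree. *)
Lemma agree_off_bad w A H c m :
  run 0 w = 0 ->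
  (forall x, x \in @orthant d -> x != 0 -> population (run x w) < population x) ->
  (0 < size w)%N -> (0 < A)%N ->
  y \in half_orthant i ->
  (forall n : nat, population (reflect_at i n%:Z y) <= n%:Z + c%:Z) ->
  \forall n \near \oo, forall s,
    ~ (lawless I `|` \bigcup_(r >= m)
        word_event I (bad_stage w A H c r) [::] (horizon w A r.+1)) s ->
    ((tau_level R n (X_walk I (reflect_at i n%:Z y) s) <
      tau_origin R (X_walk I (reflect_at i n%:Z y) s))%E <->
     (tau_diag R i (Y_walk i I y s) < +oo)%E).
Proof.
move=> w0 w_drains w_size A_gt0 y_in yc.
exists (`|y ord0 i| + horizon w A m).+1%N => // n /= n_large s /not_orP[lawful good].
have letters t : exists a : letter, nonloop a /\ I t s = hop a.
  apply: contrapT => h; apply: lawful; exists t => //= -[a ap ta].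
  by apply: h; exists a.
have [a a_spec] := choice letters.
have walkE x k : X_walk I x s k = run x (mkseq a k).
  rewrite -run_constrained_walk /X_walk; congr constrained_walk.
  by apply/funext => t; rewrite (a_spec t).2.
have {}good r : (m <= r)%N -> ~~ bad_stage w A H c r (mkseq a (horizon w A r.+1)).
  move=> mr; apply/negP => bad_at_r; apply: good; exists r => //.
  exists (mkseq a (horizon w A r.+1)); split; rewrite ?size_mkseq //.
    by apply/allP => b /mapP[t _ ->]; exact: (a_spec t).1.
  rewrite /prefix_of /= ?size_mkseq /mkseq -map_comp; apply: eq_map => t.
  exact: (a_spec t).2.
have coupled (n' : nat) k : k%:Z <= n'%:Z - y ord0 i ->
    X_walk I (reflect_at i n'%:Z y) s k = reflect_at i n'%:Z (Y_walk i I y s k) /\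
    Y_walk i I y s k ord0 i <= y ord0 i + k%:Z.
  move=> kn; apply: reflected_walk => // t.
  by rewrite (a_spec t).2; exact: hop_ge_m1.
have early (n' : nat) k : y ord0 i <= n'%:Z ->
    population (X_walk I (reflect_at i n'%:Z y) s k) = n'%:Z ->
    (forall t, X_walk I (reflect_at i n'%:Z y) s t = 0 -> (k < t)%N) ->
    (k < horizon w A m)%N.
  move=> yn kn k0; rewrite ltnNge; apply/negP => mk.
  rewrite walkE in kn.
  have [t tk] := good_path w0 w_drains w_size A_gt0 good (reflect_orthant y_in yn) (yc n') mk kn.
  by rewrite -walkE => /k0; rewrite ltnNge tk.
have nonzero (n' : nat) t : t%:Z < n'%:Z - y ord0 i ->
    X_walk I (reflect_at i n'%:Z y) s t <> 0.
  move=> tn xt; have [] := coupled n' t (ltW tn); rewrite xt => /rowP /(_ i).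
  rewrite reflect_atE eqxx mxE.
  by move: (Y_walk i I y s t ord0 i) => Yi e; lia.
rewrite level_before_originP diag_finiteP; split.
  move=> [k [kn k0]].
  have k_early : (k < horizon w A m)%N by apply: early kn k0; lia.
  exists k; apply/(population_reflect i n).
  by have [<- _] := coupled n k ltac:(lia).
move=> [k ki].
have k_early : (k < horizon w A m)%N.
  (* With this n' the X-walk cannot have reached the origin by time k. *)
  pose n' := (`|y ord0 i| + k).+1%N.
  apply: (early n' k); first by rewrite /n'; lia.
    by have [-> _] := coupled n' k ltac:(rewrite /n'; lia); apply/population_reflect.
  move=> t xt; rewrite ltnNge; apply/negP => tk.
  by apply: (nonzero n' t) xt; rewrite /n'; lia.
exists k; split.
  by have [-> _] := coupled n k ltac:(lia); apply/population_reflect.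
move=> t xt; rewrite ltnNge; apply/negP => tk.
by apply: (nonzero n t) xt; lia.
Qed.

End Conclusion.

Unset Implicit Arguments.

Theorem proposition3p1 (R : realType) (d : nat) (p : 'M[R]_d.+1)
  (nu : 'I_d -> R)
  (disp : measure_display) (T : measurableType disp) (P : probability T R)
  (I : nat -> T -> 'rV[int]_d) (i : 'I_d) (y : 'rV[int]_d)
  (d_ge2 : (2 <= d)%N)
  (p_transition : transition_matrix p)
  (p_irreducible : irreducible_matrix p)
  (nu_traffic : traffic_equation p nu)
  (stable : forall j : 'I_d, utilization p nu j < 1)
  (I_iid : iid_increments p P I)
  (y_in : y \in half_orthant i) :
  (forall n : nat, y ord0 i <= n%:Z -> reflect_at i n%:Z y \in @orthant d) /\
  P [set w | (tau_level R n (X_walk I (reflect_at i n%:Z y) w) <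
              tau_origin R (X_walk I (reflect_at i n%:Z y) w))%E]
    @[n --> \oo]
  --> P [set w | (tau_diag R i (Y_walk i I y w) < +oo)%E].
Proof.
split=> [n yn|]; first exact: reflect_orthant.
have p_irr (b : 'I_d.+1) : ~~ (0 < p b b) by rewrite transition_diag // ltxx.
have [w [w_pos w0 w_drains]] := draining_word p_irr p_irreducible.
have w_size : (0 < size w)%N.
  rewrite lt0n size_eq0; apply/eqP => w_nil.
  have eO : unit_vec (node i) \in @orthant d.
    by apply/orthantP => j; exact: unit_vec_ge0.
  have e0 : unit_vec (node i) != 0 :> 'rV[int]_d.
    apply/eqP => /rowP /(_ i); rewrite unit_vec_nodeE eqxx mxE.
    by [].
  by have := w_drains _ eO e0; rewrite w_nil ltxx.
pose c := absz (\sum_(j < d | j != i) y ord0 j - y ord0 i)%R.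
have yc (n : nat) : population (reflect_at i n%:Z y) <= n%:Z + c%:Z.
  rewrite /population (bigD1 i) //= reflect_atE eqxx.
  rewrite (eq_bigr (fun j => y ord0 j)) => [|j ji]; last first.
    by rewrite reflect_atE (negbTE ji).
  rewrite /c; move: (y ord0 i) (\sum_(j < d | _) _) => yi S; lia.
have [A [H [G [g [A0 g0 g1 rare]]]]] :=
  bad_stage_rare p_transition p_irreducible nu_traffic stable w_pos w_size c.
pose B r := word_event I (bad_stage w A H c r) [::] (horizon w A r.+1).
have mB r : measurable (B r) by exact: (measurable_word_event I_iid).
apply: (@cvg_measure_agree _ _ _ _ _ (fun m => lawless I `|` \bigcup_(r >= m) B r)).
- by move=> n; exact: (measurable_level_before_origin I_iid).
- exact: (measurable_diag_finite _ I_iid).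
- move=> m; apply: measurableU; first exact: (measurable_lawless I_iid).
  by apply: bigcup_measurable => r _.
- apply: (tail_null p_transition I_iid mB g0 g1) => r.
  apply: le_trans (word_event_le p_transition I_iid _ _ _) _ => //.
  by rewrite big_nil mul1r lee_fin; exact: rare.
- move=> m; exact: (agree_off_bad R I H m w0 w_drains w_size A0 y_in yc).
Qed.
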